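(* The matroids $\mathrm{PG}(3,2)\backslash L$ and $M^*(K_6)$ are excluded minors for the class of even-cycle matroids with a blocking pair; that is, neither is an even-cycle matroid with a blocking pair, but every proper minor of each of them is.
   Context: Even-cycle matroid: a binary matroid $M\binom{w}{D}$ where $D$ is the vertex-edge incidence matrix over $\mathrm{GF}(2)$ of a graph $G=(V,E)$ and $w$ is the characteristic vector of a set $W\subseteq E$ (odd edges); $(G,W)$ is an even-cycle representation. Resigning at a vertex $u$ replaces $W$ by its symmetric difference with the set of edges incident with $u$. Vertices $u,v$ form a blocking pair of $(G,W)$ if after some sequence of resignings every odd edge is incident with $u$ or $v$. An even-cycle matroid has a blocking pair if some even-cycle representation of it has a blocking pair. $\mathrm{PG}(3,2)\backslash L$ is $\mathrm{PG}(3,2)$ with the three points of a line deleted. *)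

(* Defs.v *)
From mathcomp Require Import all_boot all_algebra.

Set Implicit Arguments.
Unset Strict Implicit.
Unset Printing Implicit Defensive.

Import GRing.Theory.
Local Open Scope ring_scope.

Record matroid (T : finType) := Matroid {
  ground : {set T};
  indep : pred {set T};
  indep_ground : forall I, indep I -> I \subset ground;
  indep0 : indep set0;
  indep_sub : forall I J : {set T}, I \subset J -> indep J -> indep I;
  indep_aug : forall I J : {set T}, indep I -> indep J -> (#|I| < #|J|)%N ->
    exists2 e, e \in J :\: I & indep (e |: I)
}.

Definition matroid_iso (T U : finType) (M : matroid T) (N : matroid U) : Prop :=
  exists f : {x : T | x \in ground M} -> U,
    [/\ injective f,
        f @: setT = ground N
      & forall I : {set {x : T | x \in ground M}},
          indep M (val @: I) = indep N (f @: I)].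

Section MatroidOperations.

Variables (T : finType) (M : matroid T).

Definition basis (B : {set T}) : bool := maxset (indep M) B.

Lemma basisP (B : {set T}) :
  reflect (indep M B /\ forall J, indep M J -> (#|J| <= #|B|)%N) (basis B).
Proof.
apply: (iffP idP) => [mB | [iB max]].
  split=> [|J iJ]; first exact: maxsetp mB.
  rewrite leqNgt; apply/negP => /(indep_aug (maxsetp mB) iJ) [e].
  rewrite inE => /andP[eB _] ieB; case/negP: eB.
  by rewrite -(maxsetsup mB ieB (subsetUr _ _)) setU11.
apply/maxsetP; split=> // J iJ sBJ; apply/eqP.
by rewrite eq_sym eqEcard sBJ max.
Qed.

Lemma indep_extend (I S B : {set T}) :
  indep M I -> I \subset S -> basis B -> B \subset S ->
  exists2 B', basis B' & (I \subset B') && (B' \subset S).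
Proof.
move=> iI sIS /basisP[iB maxB] sBS.
have [B' mB' sIB'] : {B' | maxset (fun J => indep M J && (J \subset S)) B' & I \subset B'}.
  by apply: maxset_exists; rewrite iI.
have /andP[iB' sB'S] := maxsetp mB'.
exists B'; last by rewrite sIB'.
apply/basisP; split=> // J iJ; apply: leq_trans (maxB J iJ) _.
rewrite leqNgt; apply/negP => /(indep_aug iB' iB) [e].
rewrite inE => /andP[eB' eB] ieB'; case/negP: eB'.
have H : indep M (e |: B') && (e |: B' \subset S).
  by rewrite ieB' subUset sB'S sub1set (subsetP sBS).
by rewrite -(maxsetsup mB' H (subsetUr _ _)) setU11.
Qed.

Definition delete_indep (D I : {set T}) := indep M I && [disjoint I & D].

Lemma delete_ground D I : delete_indep D I -> I \subset ground M :\: D.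
Proof. by case/andP=> /indep_ground sI dI; rewrite subsetD sI. Qed.

Lemma delete0 D : delete_indep D set0.
Proof. by rewrite /delete_indep indep0 -setI_eq0 set0I eqxx. Qed.

Lemma delete_sub D (I J : {set T}) :
  I \subset J -> delete_indep D J -> delete_indep D I.
Proof.
move=> sIJ /andP[iJ dJ]; rewrite /delete_indep (indep_sub sIJ iJ).
exact: disjointWl sIJ dJ.
Qed.

Lemma delete_aug D (I J : {set T}) :
  delete_indep D I -> delete_indep D J -> (#|I| < #|J|)%N ->
  exists2 e, e \in J :\: I & delete_indep D (e |: I).
Proof.
case/andP=> iI dI /andP[iJ dJ] /(indep_aug iI iJ)[e eJI ieI]; exists e => //.
rewrite /delete_indep ieI -setI_eq0 setIUl setU_eq0 !setI_eq0 dI andbT.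
by move: eJI; rewrite inE disjoints1 => /andP[_ /(disjointFr dJ) ->].
Qed.

Definition delete (D : {set T}) : matroid T :=
  Matroid (@delete_ground D) (delete0 D) (@delete_sub D) (@delete_aug D).

(* The bases of the dual are the complements of the bases of [M]. *)
Definition dual_indep (I : {set T}) :=
  (I \subset ground M) && [exists B : {set T}, basis B && [disjoint I & B]].

Lemma dual_ground I : dual_indep I -> I \subset ground M.
Proof. by case/andP. Qed.

Lemma dual0 : dual_indep set0.
Proof.
rewrite /dual_indep sub0set; apply/existsP.
have [B mB _] := maxset_exists (indep0 M).
by exists B; rewrite /basis mB -setI_eq0 set0I eqxx.
Qed.

Lemma dual_sub (I J : {set T}) : I \subset J -> dual_indep J -> dual_indep I.
Proof.
move=> sIJ /andP[sJ /existsP[B /andP[bB dJB]]].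
rewrite /dual_indep (subset_trans sIJ sJ); apply/existsP; exists B.
by rewrite bB (disjointWl sIJ dJB).
Qed.

Lemma dual_aug (I J : {set T}) :
  dual_indep I -> dual_indep J -> (#|I| < #|J|)%N ->
  exists2 e, e \in J :\: I & dual_indep (e |: I).
Proof.
case/andP=> sI /existsP[A /andP[bA dIA]] /andP[sJ /existsP[B /andP[bB dJB]]] ltIJ.
have iB := maxsetp bB.
have [B' bB' /andP[sBB' sB'I]] :
    exists2 B', basis B' & (B :\: I \subset B') && (B' \subset ~: I).
  apply: (indep_extend (indep_sub (subsetDl B I) iB) _ bA).
    by rewrite setDE subsetIr.
  by rewrite -disjoints_subset disjoint_sym.
have [sJIB' | /subsetPn[e eJI eB']] := boolP (J :\: I \subset B'); last first.
  exists e => //; move: eJI; rewrite inE => /andP[eI eJ].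
  rewrite /dual_indep subUset sub1set (subsetP sJ) // sI /=.
  apply/existsP; exists B'; rewrite bB' -setI_eq0 setIUl setU_eq0 !setI_eq0.
  by rewrite disjoints1 eB' disjoint_sym disjoints_subset sB'I.
have leBB' : (#|B'| <= #|B|)%N.
  by have /basisP[iB' _] := bB'; have /basisP[_] := bB; apply.
have d1 : [disjoint J :\: I & B :\: I].
  by apply: disjointWl (subsetDl _ _) _; apply: disjointWr (subsetDl _ _) _.
have le1 : (#|J :\: I| + #|B :\: I| <= #|B'|)%N.
  rewrite -cardsUI (_ : _ :&: _ = set0); last by apply/eqP; rewrite setI_eq0.
  by rewrite cards0 addn0 subset_leq_card // subUset sJIB' sBB'.
have le2 : (#|B :&: I| <= #|I :\: J|)%N.
  apply/subset_leq_card/subsetP => x; rewrite !inE => /andP[xB ->].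
  by rewrite (disjointFl dJB xB).
have := cardsID I B; have := cardsID I J; have := cardsID J I => eI eJ eB.
suff: (#|B| < #|B'|)%N by rewrite ltnNge leBB'.
apply: leq_trans le1; rewrite -eB -addSn leq_add2r.
apply: leq_ltn_trans le2 _.
by rewrite -(ltn_add2l #|I :&: J|) eI setIC eJ.
Qed.

Definition dual : matroid T := Matroid dual_ground dual0 dual_sub dual_aug.

End MatroidOperations.

Definition contract (T : finType) (M : matroid T) (C : {set T}) : matroid T :=
  dual (delete (dual M) C).

Definition matroid_class := forall T : finType, matroid T -> Prop.

Definition excluded_minor (P : matroid_class) (T : finType) (M : matroid T) : Prop :=
  ~ P T M /\
  forall C D : {set T},
    C \subset ground M -> D \subset ground M -> [disjoint C & D] ->
    C :|: D != set0 -> P T (delete (contract M C) D).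

Section VectorMatroid.

Variables (F : fieldType) (vT : vectType F) (T : finType).
Variables (f : T -> vT) (S : {set T}).

(* [free] looks at the list, so equal vectors with distinct labels count as
   dependent. *)
Definition vector_indep (I : {set T}) := (I \subset S) && free [seq f e | e <- enum I].

Lemma free_setU1 (e : T) (I : {set T}) : e \notin I ->
  free [seq f x | x <- enum (e |: I)] = free (f e :: [seq f x | x <- enum I]).
Proof.
move=> eI; rewrite -map_cons; apply/perm_free/perm_map/uniq_perm.
- exact: enum_uniq.
- by rewrite /= mem_enum eI enum_uniq.
- by move=> x; rewrite inE !mem_enum !inE.
Qed.

Lemma free_subset (I J : {set T}) : I \subset J ->
  free [seq f x | x <- enum J] -> free [seq f x | x <- enum I].
Proof.
move=> sIJ; have /perm_free -> : perm_eq [seq f x | x <- enum J]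
    ([seq f x | x <- enum I] ++ [seq f x | x <- enum (J :\: I)]).
  rewrite -map_cat; apply/perm_map/uniq_perm.
  - exact: enum_uniq.
  - rewrite cat_uniq !enum_uniq andbT -all_predC; apply/allP => x /=.
    by rewrite !mem_enum inE => /andP[].
  - move=> x; rewrite mem_cat !mem_enum inE.
    by case: (boolP (x \in I)) => //= /(subsetP sIJ).
exact: catl_free.
Qed.

Lemma vector_ground I : vector_indep I -> I \subset S.
Proof. by case/andP. Qed.

Lemma vector0 : vector_indep set0.
Proof. by rewrite /vector_indep sub0set enum_set0 nil_free. Qed.

Lemma vector_sub (I J : {set T}) : I \subset J -> vector_indep J -> vector_indep I.
Proof.
move=> sIJ /andP[sJ fJ].
by rewrite /vector_indep (subset_trans sIJ sJ) (free_subset sIJ fJ).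
Qed.

Lemma vector_aug (I J : {set T}) :
  vector_indep I -> vector_indep J -> (#|I| < #|J|)%N ->
  exists2 e, e \in J :\: I & vector_indep (e |: I).
Proof.
case/andP=> sI fI /andP[sJ fJ] ltIJ.
have [sub | ] := boolP (all (mem <<[seq f x | x <- enum I]>>%VS) [seq f x | x <- enum J]).
  have /dimvS : (<<[seq f x | x <- enum J]>> <= <<[seq f x | x <- enum I]>>)%VS.
    by apply/span_subvP/allP.
  move: fI fJ; rewrite /free => /eqP-> /eqP->.
  by rewrite !size_map -!cardE leqNgt ltIJ.
rewrite -has_predC => /hasP[x /mapP[e]]; rewrite mem_enum => eJ {x}-> /= enI.
have eI : e \notin I.
  by apply: contra enI => eI; rewrite memv_span // map_f // mem_enum.
exists e; first by rewrite inE eI.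
rewrite /vector_indep subUset sub1set (subsetP sJ) // sI free_setU1 //.
by rewrite free_cons fI !andbT /=.
Qed.

Definition vector_matroid : matroid T :=
  Matroid vector_ground vector0 vector_sub vector_aug.

End VectorMatroid.

(* The columns of [A] are labelled by [T] through [enum_rank]. *)
Definition matrix_matroid (F : fieldType) (T : finType) (m : nat)
    (A : 'M[F]_(m, #|T|)) : matroid T :=
  vector_matroid (fun e => col (enum_rank e) A) [set: T].

(* Over GF(2), a point of projective space is spanned by a unique nonzero vector. *)
Definition PG32 : matroid 'rV['F_2]_4 := vector_matroid (fun x : 'rV['F_2]_4 => x) [set x | x != 0].

Definition PG32_line (L : {set 'rV['F_2]_4}) : Prop :=
  exists x y, [/\ x != 0, y != 0, x != y & L = [set x; y; x + y]].

(* Parallel edges are allowed; a loop is an edge whose set of ends is a singleton. *)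
Record graph := Graph {
  vertex : finType;
  edge : finType;
  ends : edge -> {set vertex};
  ends_card : forall e, (0 < #|ends e| <= 2)%N
}.

(* The column of a loop is zero. *)
Definition incidence_mx (G : graph) : 'M['F_2]_(#|vertex G|, #|edge G|) :=
  \matrix_(i, j) ((enum_val i \in ends (enum_val j)) && (#|ends (enum_val j)| == 2))%:R.

(* Vertices vs_0, ..., vs_(k-1) are distinct and the i-th edge has ends vs_i and
   vs_(i+1 mod k); a loop is a cycle with k = 1 and a pair of parallel edges is
   one with k = 2. *)
Definition is_cycle (G : graph) (C : {set edge G}) : bool :=
  (C != set0) &&
  [exists vs : #|C|.-tuple (vertex G), [exists es : #|C|.-tuple (edge G),
    [&& uniq vs, uniq es, C == [set e in es]
      & [seq ends e | e <- es] == [seq [set p.1; p.2] | p <- zip vs (rot 1 vs)]]]].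

Definition acyclic (G : graph) (I : {set edge G}) : bool :=
  [forall C : {set edge G}, is_cycle C ==> ~~ (C \subset I)].

Section CycleMatroid.

Lemma F2_neq0 (x : 'F_2) : x != 0 -> x = 1.
Proof. by case: x => [[|[|?]]] // ? _; apply: val_inj. Qed.

Lemma F2_free (vT : vectType 'F_2) (T : finType) (f : T -> vT) (I : {set T}) :
  reflect (forall S : {set T}, S \subset I -> \sum_(e in S) f e = 0 -> S = set0)
          (free [seq f e | e <- enum I]).
Proof.
apply: (iffP idP) => [fI S sSI S0 | noS].
  apply/eqP/set0Pn => -[e eS].
  have := free_subset sSI fI; rewrite -(setD1K eS) free_setU1 ?setD11 //.
  rewrite free_cons => /andP[/negP[]].
  have -> : f e = - \sum_(x in S :\ e) f x.
    by apply/eqP; rewrite -addr_eq0 -big_setD1 ?S0.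
  rewrite memvN; apply: memv_suml => x xS.
  by rewrite memv_span // map_f // mem_enum.
pose X := [tuple f (enum_val i) | i < #|I|].
have -> : [seq f e | e <- enum I] = X.
  by rewrite /= -{1}(map_tnth_enum (enum_tuple I)) -map_comp; apply: eq_map => i /=;
     rewrite (tnth_nth (enum_default i)).
apply/freeP => k k0 i; apply/eqP/negPn/negP => ki.
have: [set enum_val j | j in [set j | k j != 0]] = set0; last first.
  by move/setP/(_ (enum_val i)); rewrite in_set0 imset_f // inE.
apply: noS.
- by apply/subsetP => _ /imsetP[j _ ->]; apply: enum_valP.
- rewrite big_imset /=; last by move=> ? ? _ _; apply: enum_val_inj.
  rewrite -[RHS]k0 [RHS](bigID (fun j => k j != 0)) /=.
  rewrite [X in _ = _ + X]big1 ?addr0 => [|j /negPn/eqP->]; last by rewrite scale0r.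
  apply: eq_big => [j | j]; rewrite inE // => /F2_neq0 ->.
  by rewrite scale1r nth_mktuple.
Qed.

Variable G : graph.
Local Notation V := (vertex G).
Local Notation E := (edge G).

Definition inc_col (e : E) : 'cV['F_2]_#|V| := col (enum_rank e) (incidence_mx G).

Lemma inc_colE (e : E) (a b : V) : ends e = [set a; b] ->
  inc_col e = delta_mx (enum_rank a) 0 + delta_mx (enum_rank b) 0.
Proof.
move=> He; apply/matrixP => i j; rewrite !mxE enum_rankK He ord1 !eqxx !andbT.
rewrite cards2 !inE -[i]enum_valK !(inj_eq enum_rank_inj) enum_valK.
move: (enum_val i) => x {i j}.
have [<-{b He} | nab] := eqVneq a b.
  by rewrite andbF; case: eqP => _; apply: val_inj.
rewrite andbT; have [->|_] := eqVneq x a; first by rewrite (negbTE nab) addr0.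
by rewrite add0r.
Qed.

Lemma cycle_sum (C : {set E}) : is_cycle C -> \sum_(e in C) inc_col e = 0.
Proof.
case/andP=> _ /existsP[vs /existsP[es /and4P[_ ues /eqP/setP HC /eqP Hes]]].
rewrite (eq_bigl (fun e => e \in es)) => [|e]; last by rewrite HC inE.
rewrite -big_uniq //=.
pose h (v : V) : 'cV['F_2]_#|V| := delta_mx (enum_rank v) 0.
have szv : size (rot 1 vs) = size vs by rewrite size_rot.
have szz : size (zip vs (rot 1 vs)) = size es.
  by rewrite size_zip szv minnn !size_tuple.
have -> : \sum_(e <- es) inc_col e = \sum_(p <- zip vs (rot 1 vs)) (h p.1 + h p.2).
  elim: (tval es) (zip _ _) Hes {szz} => [|e s IH] [|p z] //=; first by rewrite !big_nil.
  by case=> He /IH Hs; rewrite !big_cons Hs (inc_colE He).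
rewrite big_split /= -(big_map fst xpredT h) -(big_map snd xpredT h).
rewrite -/(unzip1 _) -/(unzip2 _).
rewrite unzip1_zip ?szv // unzip2_zip ?szv //.
rewrite [X in _ + X](perm_big vs) /=; last by rewrite perm_rot.
by rewrite -mulr2n -scaler_nat (_ : 2%:R = 0 :> 'F_2) ?scale0r //; apply: val_inj.
Qed.

Lemma loop_cycle (e : E) (a : V) : ends e = [set a] -> is_cycle [set e].
Proof.
move=> He; apply/andP; split; first by apply/set0Pn; exists e; rewrite inE.
rewrite /= cards1; apply/existsP; exists [tuple a]; apply/existsP; exists [tuple e].
apply/and4P; split=> //=; first by apply/eqP/setP => x; rewrite !inE.
by rewrite He; apply/eqP; congr [:: _]; apply/setP => x; rewrite !inE orbb.
Qed.

Lemma sum0_degree (S : {set E}) (e : E) (v : V) :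
  \sum_(x in S) inc_col x = 0 -> e \in S -> #|ends e| = 2 -> v \in ends e ->
  exists x, [&& x \in S, x != e & v \in ends x].
Proof.
move=> S0 eS c2 ve; apply/existsP; apply: contraT; rewrite negb_exists => /forallP no.
have /matrixP/(_ (enum_rank v) 0) := S0.
rewrite summxE (big_setD1 e) //= big1 ?addr0.
  by rewrite !mxE !enum_rankK ve c2.
move=> x; rewrite inE in_set1 => /andP[xe xS]; rewrite !mxE !enum_rankK.
by have := no x; rewrite xS xe /= => /negbTE->.
Qed.

Lemma walk_cycle (S : {set E}) (v : nat -> V) (e : nat -> E) (i j : nat) :
  (i < j)%N -> v j = v i -> (forall k, e k \in S) -> (forall k, e k.+1 != e k) ->
  (forall k, ends (e k) = [set v k; v k.+1]) ->
  (forall a b, (a < j)%N -> (b < j)%N -> v a = v b -> a = b) ->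
  exists2 C : {set E}, is_cycle C & C \subset S.
Proof.
move=> ij vij eS ne He vinj; pose s := iota i (j - i).
have ms k : (k \in s) = (i <= k < j)%N by rewrite mem_iota subnKC // ltnW.
have uv : uniq (map v s).
  rewrite map_inj_in_uniq ?iota_uniq // => a b; rewrite !ms => /andP[_ aj] /andP[_ bj].
  exact: vinj.
have lt_e a b : (a < b < j)%N -> e a <> e b.
  case/andP=> ab bj eab; have := He b; rewrite -eab He => /setP Hs.
  have aj := ltn_trans ab bj.
  have := Hs (v b); rewrite !inE eqxx /= => /orP[] /eqP.
    by move/(vinj _ _ bj aj) => H; rewrite H ltnn in ab.
  move/(vinj _ _ bj (leq_ltn_trans ab bj)) => H.
  by have := ne a; rewrite -H -eab eqxx.
have ue : uniq (map e s).
  rewrite map_inj_in_uniq ?iota_uniq // => a b; rewrite !ms => /andP[_ aj] /andP[_ bj] eab.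
  case: (ltngtP a b) => // ab; exfalso.
    by apply: (lt_e a b) => //; rewrite ab.
  by apply: (lt_e b a) => //; rewrite ab.
pose C := [set x in map e s]; exists C; last first.
  by apply/subsetP => x; rewrite inE => /mapP[k _ ->].
have cC : #|C| = size s by rewrite cardsE (card_uniqP ue) size_map.
have szs : size s = (j - i)%N by rewrite size_iota.
apply/andP; split; first by rewrite -card_gt0 cC szs subn_gt0.
have tv : size (map v s) == #|C| by rewrite size_map cC.
have te : size (map e s) == #|C| by rewrite size_map cC.
apply/existsP; exists (Tuple tv); apply/existsP; exists (Tuple te).
rewrite /= uv ue eqxx /=; apply/eqP.
have -> : rot 1 (map v s) = map (fun k => v k.+1) s.
  have [n jn] : exists n, j = (i + n).+1 by exists (j - i.+1)%N; rewrite -addSn subnKC.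
  rewrite /s jn -addnS addKn /= rot1_cons -vij jn.
  elim: n (i) {jn} => [|n IH] m /=; first by rewrite addn0.
  by rewrite addnS -addSn IH.
by rewrite -map_comp zip_map -map_comp; apply: eq_map => k /=.
Qed.

Lemma sum0_cycle (S : {set E}) : S != set0 -> \sum_(e in S) inc_col e = 0 ->
  exists2 C : {set E}, is_cycle C & C \subset S.
Proof.
move=> /set0Pn[e0 e0S] S0.
have [/existsP[e /andP[eS /cards1P[a Ha]]] | noloop] := boolP [exists e in S, #|ends e| == 1%N].
  by exists [set e]; [exact: loop_cycle Ha | rewrite sub1set].
have c2 e : e \in S -> #|ends e| = 2.
  move=> eS; move: noloop; rewrite negb_exists => /forallP/(_ e); rewrite eS /=.
  by case/andP: (ends_card e); case: #|_| => [|[|[|]]].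
pose dart (d : V * E) := (d.2 \in S) && (d.1 \in ends d.2).
pose step (d d' : V * E) :=
  [&& dart d', d'.2 != d.2 & ends d.2 == [set d.1; d'.1]].
have ex_step d : dart d -> exists d', step d d'.
  case: d => x e /andP[/= eS xe].
  have /cards2P[a [b [nab Hab]]] : #|ends e| == 2 by rewrite c2.
  have [y Hy] : exists y, ends e = [set x; y].
    move: xe; rewrite Hab !inE => /orP[]/eqP->; first by exists b.
    by exists a; rewrite setUC.
  have [|e' /and3P[e'S ne ye]] := sum0_degree (v := y) S0 eS (c2 _ eS).
    by rewrite Hy !inE eqxx orbT.
  by exists (y, e'); rewrite /step /dart /= e'S ye ne Hy eqxx.
have [d0 d0P] : exists d0, dart d0.
  have /card_gt0P[x xe] : (0 < #|ends e0|)%N by rewrite c2.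
  by exists (x, e0); rewrite /dart /= e0S.
pose next d := odflt d [pick d' | step d d'].
have nextP d : dart d -> step d (next d).
  move=> dd; rewrite /next; case: pickP => //= no.
  by have [d'] := ex_step _ dd; rewrite no.
pose w k := iter k next d0.
have wP k : dart (w k).
  by elim: k => //= k IH; have /and3P[] := nextP _ IH.
pose v k := (w k).1; pose e k := (w k).2.
have rep : exists j, v j \in [seq v k | k <- iota 0 j].
  have [/hasP[j _ Hj] | no] := boolP (has (fun j => v j \in [seq v k | k <- iota 0 j]) (iota 0 #|V|.+1)).
    by exists j.
  have u n : (n <= #|V|.+1)%N -> uniq [seq v k | k <- iota 0 n].
    elim: n => // n IH ln; rewrite -addn1 iotaD map_cat /= cats1 rcons_uniq IH ?(ltnW ln) // andbT.
    by move: no => /hasPn; apply; rewrite mem_iota.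
  have := u _ (leqnn _) => /card_uniqP; rewrite size_map size_iota => H.
  by have := max_card (mem [seq v k | k <- iota 0 #|V|.+1]); rewrite H ltnn.
case: (ex_minnP rep) => j /mapP[i]; rewrite mem_iota /= add0n => ij vij jmin.
have lt_v a b : (a < b < j)%N -> v a <> v b.
  case/andP=> ab bj vab; have := jmin b; rewrite leqNgt bj => H.
  by suff: false by []; apply: H; rewrite -vab map_f // mem_iota.
apply: (walk_cycle (v := v) (e := e) ij vij) => [k|k|k|a b aj bj vab].
- by case/andP: (wP k).
- by case/and3P: (nextP _ (wP k)).
- by case/and3P: (nextP _ (wP k)) => _ _ /eqP.
- case: (ltngtP a b) => // ab; exfalso.
    by apply: (lt_v a b) => //; rewrite ab.
  by apply: (lt_v b a) => //; rewrite ab.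
Qed.

Lemma acyclicE (I : {set E}) : acyclic I = free [seq inc_col e | e <- enum I].
Proof.
apply/forallP/F2_free => [noC S sSI S0 | noS C].
  apply/eqP/negPn/negP => /sum0_cycle/(_ S0)[C cC sCS].
  by have := noC C; rewrite cC (subset_trans sCS sSI).
apply/implyP => cC; apply/negP => sCI.
by have := cC; rewrite /is_cycle (noS C sCI (cycle_sum cC)) eqxx.
Qed.

Lemma cycle_ground (I : {set E}) : acyclic I -> I \subset [set: E].
Proof. by rewrite subsetT. Qed.

Lemma cycle0 : acyclic (set0 : {set E}).
Proof. by rewrite acyclicE enum_set0 nil_free. Qed.

Lemma cycle_sub (I J : {set E}) : I \subset J -> acyclic J -> acyclic I.
Proof. by move=> sIJ; rewrite !acyclicE; apply: free_subset. Qed.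

Lemma cycle_aug (I J : {set E}) : acyclic I -> acyclic J -> (#|I| < #|J|)%N ->
  exists2 e, e \in J :\: I & acyclic (e |: I).
Proof.
rewrite !acyclicE => aI aJ ltIJ.
have := @vector_aug _ _ _ inc_col setT I J.
rewrite /vector_indep !subsetT => /(_ aI aJ ltIJ)[e eJI /andP[_ fe]].
by exists e; rewrite // acyclicE.
Qed.

Definition cycle_matroid : matroid E :=
  Matroid cycle_ground cycle0 cycle_sub cycle_aug.

End CycleMatroid.

Definition complete_edge (n : nat) := {e : {set 'I_n} | #|e| == 2}.

Lemma complete_ends_card n (e : complete_edge n) : (0 < #|val e| <= 2)%N.
Proof. by rewrite (eqP (valP e)). Qed.

Definition complete_graph (n : nat) : graph :=
  @Graph 'I_n (complete_edge n : finType) val (@complete_ends_card n).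

Definition char_row (T : finType) (W : {set T}) : 'rV['F_2]_#|T| :=
  \row_j (enum_val j \in W)%:R.

Definition even_cycle_matroid (G : graph) (W : {set edge G}) : matroid (edge G) :=
  matrix_matroid (col_mx (char_row W) (incidence_mx G)).

Definition even_cycle_rep (T : finType) (M : matroid T) (G : graph) (W : {set edge G}) :
  Prop := matroid_iso M (even_cycle_matroid W).

(* The support of the row of [u] in the incidence matrix: adding that row to the
   characteristic vector of [W] leaves the matroid unchanged, and in particular
   loops keep their parity. *)
Definition star (G : graph) (u : vertex G) : {set edge G} :=
  [set e | incidence_mx G (enum_rank u) (enum_rank e) != 0].

Definition resign (G : graph) (W : {set edge G}) (u : vertex G) : {set edge G} :=
  (W :\: star u) :|: (star u :\: W).

Definition blocking_pair (G : graph) (W : {set edge G}) (u v : vertex G) : Prop :=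
  u != v /\
  exists us : seq (vertex G),
    forall e, e \in foldl (@resign G) W us -> (u \in ends e) || (v \in ends e).

Definition even_cycle_with_blocking_pair : matroid_class := fun T M =>
  exists (G : graph) (W : {set edge G}),
    even_cycle_rep M W /\ exists u v : vertex G, blocking_pair W u v.

(* Main.v *)
Require Import Defs.
From mathcomp Require Import all_boot all_algebra perm zify ring.

(** Resigning so that every odd edge meets [u] or [v], and measuring vertices from
    [u], a signed graph with blocking pair [u, v] is a binary matrix with columns in
    [F_2^2 + F_2^n], where [F_2^2] is spanned by the odd loop and the edge [uv]: each
    column is [(t, e_a)], [(t, 0)] or [(0, e_a + e_b)]. This shape survives deletion
    and contraction, so only single-element minors need explicit matrices.

    For the converse, let [P, Q] be the two rows in [F_2^2], [R_a] the other rows and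
    [R] their sum (the star of [u]). A column lies in at most two of the [R_a], in at
    most one of them if it lies in [R], and in none of them if it lies in [P] or [Q]
    but not in [R]. With [m] columns, rank [r], nonzero cocycles of weight at least
    [w], [k] nonzero rows [R_a], [d] the rank of [P, Q, R] and [s] the size of their
    joint support, this gives [w k + 2 s <= |R| + 2 m] and [r <= d + k - 1], while
    averaging over the span of [P, Q, R] gives [2 w (2^d - 1) <= 2^d s]. For
    [PG(3,2) \ L] ([r = 4], [m = 12], [w = 6], [|R| <= 8]) this is contradictory; for
    [M*(K_6)] ([r = 10], [m = 15], [w = 3]) it forces [d = 3] and [s = |R| = 6], and
    then [P], [Q], [P + Q] all have weight 3, which is impossible by parity. *)

Set Implicit Arguments.
Unset Strict Implicit.
Unset Printing Implicit Defensive.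

Import GRing.Theory.

(** * Binary matroids and their cycle spaces *)

Ltac card_lia :=
  repeat match goal with |- context [@card ?T ?A] => generalize (@card T A) end;
  clear; intros; lia.

Section CycleSpaces.

Variable T : finType.
Implicit Types (M : matroid T) (Z : pred {set T}) (A B C I J S X Y : {set T}).

Definition symdiff A B : {set T} := [set x | (x \in A) (+) (x \in B)].

Definition cycle_space Z := Z set0 /\ forall A B, Z A -> Z B -> Z (symdiff A B).

(** A binary matroid is handled through its space [Z] of cycles and not through a matrix, so that
    deletion and contraction act without a choice of coordinates. *)
Definition represented M Z := forall I,
  indep M I <-> I \subset ground M /\ forall S, S \subset I -> Z S -> S = set0.

Lemma represented_dep M Z I : represented M Z -> I \subset ground M ->
  ~~ indep M I -> exists S, [/\ S \subset I, Z S & S != set0].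
Proof.
move=> repM sI nI.
have [/existsP[S /and3P[sS zS nS]]|no] :=
  boolP [exists S : {set T}, [&& S \subset I, Z S & S != set0]]; first by exists S.
case/negP: nI; apply/repM; split=> // S sS zS.
apply/eqP; apply: contraNT no => nS; apply/existsP; exists S; exact/and3P.
Qed.

Lemma eq_represented M Z1 Z2 :
  (forall S, S \subset ground M -> Z1 S = Z2 S) ->
  represented M Z1 -> represented M Z2.
Proof.
move=> eqZ rep I; rewrite rep; split=> -[sI H]; split=> // S sS zS; apply: H => //.
  by rewrite eqZ // (subset_trans sS).
by rewrite -eqZ // (subset_trans sS).
Qed.

Lemma represented_delete M Z D : represented M Z -> represented (delete M D) Z.
Proof.
move=> rep I; rewrite /= /delete_indep subsetD; split=> [/andP[/rep[-> H] ->] //|].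
by case=> /andP[sI ->] H; rewrite andbT; apply/rep.
Qed.

(* A binary matroid determines its cycle space: the minimal nonempty members of
   [Z] are the circuits, and they generate [Z]. *)
Lemma represented_sub M Z1 Z2 : cycle_space Z1 -> cycle_space Z2 ->
  represented M Z1 -> represented M Z2 ->
  forall S, S \subset ground M -> Z1 S -> Z2 S.
Proof.
move=> [z10 z1D] [z20 z2D] rep1 rep2 S.
have [n] := ubnP #|S|; elim: n S => // n IH S leS sS zS.
have [->//|nS] := eqVneq S set0.
have [|C /minsetP[/andP[nC zC] minC] sCS] :=
  @minset_exists _ (fun C : {set T} => (C != set0) && Z1 C) S; first by rewrite nS.
have sC := subset_trans sCS sS.
(* [C] contains a nonempty member [D] of [Z2]; this is dependent, so it contains a nonempty member
   of [Z1], and minimality of [C] forces [D = C]. *)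
have zC2 : Z2 C.
  have nI : ~~ indep M C.
    by apply/negP => /rep1[_ /(_ C (subxx _) zC)] /eqP; rewrite (negbTE nC).
  have [D [sD zD nD]] := represented_dep rep2 sC nI.
  have nI' : ~~ indep M D.
    by apply/negP => /rep2[_ /(_ D (subxx _) zD)] /eqP; rewrite (negbTE nD).
  have [E [sE zE nE]] := represented_dep rep1 (subset_trans sD sC) nI'.
  have eEC : E = C by apply: minC; rewrite ?nE // (subset_trans sE).
  by rewrite (_ : C = D) //; apply/eqP; rewrite eqEsubset sD -{1}eEC sE.
have eD : symdiff S C = S :\: C.
  by apply/setP => x; rewrite !inE; case: (boolP (x \in C)) => [/(subsetP sCS)->|_] //=; rewrite addbF.
have zSC : Z2 (symdiff S C).
  apply: IH; last exact: z1D.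
    rewrite eD; rewrite ltnS in leS; apply: leq_trans leS; rewrite proper_card // properEneq subsetDl andbT.
    case/set0Pn: nC => x xC; apply/eqP => /setP/(_ x).
    by rewrite inE xC (subsetP sCS).
  by rewrite eD (subset_trans (subsetDl _ _)).
have -> : S = symdiff (symdiff S C) C.
  by apply/setP => x; rewrite !inE addbK.
exact: z2D.
Qed.

Lemma represented_uniq M Z1 Z2 : cycle_space Z1 -> cycle_space Z2 ->
  represented M Z1 -> represented M Z2 ->
  forall S, S \subset ground M -> Z1 S = Z2 S.
Proof.
by move=> c1 c2 r1 r2 S sS; apply/idP/idP; [apply: (represented_sub c1 c2 r1 r2) | apply: (represented_sub c2 c1 r2 r1)].
Qed.

(** Contraction projects the cycle space away from [C]; [Y] is the part of the cycle that is
    forgotten. *)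
Definition contract_cycles Z C : pred {set T} :=
  fun X => [exists Y : {set T}, (Y \subset C) && Z (X :|: Y)].

(** Since [contract] is defined through the dual, the bases of [M^*\C] are needed. By this lemma and
    [codelete_sub] they occur among the sets [ground M :\: C :\: A] with [A] a basis of [M]; by
    [card_codelete] the largest of these come from the [A] with the largest trace on [C]. *)
Lemma basis_codelete M C A : basis M A ->
  delete_indep (dual M) C (ground M :\: C :\: A).
Proof.
move=> bA; apply/andP; split; last first.
  rewrite -setI_eq0; apply/eqP/setP => x; rewrite !inE.
  by case: (x \in C); rewrite ?andbF.
apply/andP; split.
  by apply: subset_trans (subsetDl _ _) (subsetDl _ _).
apply/existsP; exists A; rewrite bA -setI_eq0; apply/eqP/setP => x; rewrite !inE.
by case: (x \in A); rewrite ?andbF.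
Qed.

Lemma codelete_sub M C J : delete_indep (dual M) C J ->
  exists2 A, basis M A & J \subset ground M :\: C :\: A.
Proof.
case/andP=> /andP[sJ /existsP[A /andP[bA dA]]] dC; exists A => //.
by rewrite !subsetD sJ dC dA.
Qed.

Lemma basis_sub_ground M A : basis M A -> A \subset ground M.
Proof. by move=> /basisP[/indep_ground]. Qed.

Lemma card_codelete M C A : C \subset ground M -> basis M A ->
  (#|ground M :\: C :\: A| + #|A| = #|ground M :\: C| + #|A :&: C|)%N.
Proof.
move=> sC bA; have sA := basis_sub_ground bA.
have := cardsID A (ground M :\: C); have := cardsID C A.
suff -> : (ground M :\: C) :&: A = A :\: C by card_lia.
apply/setP => x; rewrite !inE; case: (boolP (x \in A)) => [/(subsetP sA)->|_];
  by rewrite ?andbF ?andbT.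
Qed.

Lemma card_basis M A B : basis M A -> basis M B -> #|A| = #|B|.
Proof.
move=> /basisP[iA mA] /basisP[iB mB]; apply/eqP.
by rewrite eqn_leq mA // mB.
Qed.

(** Forward, a basis of [M^*\C] disjoint from [I] yields a basis [A] of [M] that contains [I] and
    whose trace spans [C], so a cycle in [I :|: C] reduces, modulo cycles inside [C], to a subset of
    [A], which is empty. Backward, [I] together with a maximal independent subset of [C] is
    independent, and a basis around it has the largest possible trace on [C]. *)
Lemma represented_contract M Z C : cycle_space Z -> C \subset ground M ->
  represented M Z -> represented (contract M C) (contract_cycles Z C).
Proof.
move=> [z0 zD] sC rep I; split.
- case/andP=> sI /existsP[J /andP[/basisP[iJ maxJ] dIJ]]; split=> //.
  have [A bA sJA] := codelete_sub iJ.
  have eJ : J = ground M :\: C :\: A.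
    by apply/eqP; rewrite eqEcard sJA; apply/maxJ/basis_codelete.
  have sA := basis_sub_ground bA; have [iA _] := basisP _ _ bA.
  have sIA : I \subset A.
    apply/subsetP => x xI; have := disjointFr dIJ xI; rewrite eJ inE.
    by rewrite (subsetP sI x xI) andbT => /negbFE.
  (* Otherwise [y |: (A :&: C)] extends to a basis with a larger trace on [C], against the
     maximality of [J]. *)
  have depC y : y \in C -> y \notin A -> ~~ indep M (y |: (A :&: C)).
    move=> yC yA; apply/negP => iy.
    have [|A' bA' /andP[sA1 sA2]] := indep_extend (S := y |: A) iy _ bA (subsetUr _ _).
      by rewrite setUS // subsetIl.
    have := maxJ _ (basis_codelete C bA'); rewrite eJ.
    have := card_codelete sC bA; have := card_codelete sC bA'.
    rewrite (card_basis bA' bA).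
    suff : (#|A :&: C| < #|A' :&: C|)%N by card_lia.
    suff : (#|y |: (A :&: C)| <= #|A' :&: C|)%N by rewrite cardsU1 inE (negbTE yA).
    by rewrite subset_leq_card // subsetI sA1 subUset sub1set yC subsetIr.
  (* An element [y] of [W] outside [A] lies in [C]. Adding to [W] a cycle through [y] inside
     [y |: (A :&: C)] removes [y], adds nothing outside [A] and changes nothing outside [C]. *)
  have key n W : (#|W :\: A| < n)%N -> W \subset I :|: C -> Z W -> W :\: C = set0.
    elim: n W => // n IH W ltn sW zW.
    have [W0|/set0Pn[y]] := eqVneq (W :\: A) set0.
      have sWA : W \subset A by rewrite -setD_eq0 W0.
      by have /rep[_ /(_ W sWA zW) ->] := iA; rewrite set0D.
    rewrite inE => /andP[yA yW].
    have yC : y \in C.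
      by have := subsetP sW y yW; rewrite inE => /orP[/(subsetP sIA)|//]; rewrite (negbTE yA).
    have sy : y |: (A :&: C) \subset ground M.
      by rewrite subUset sub1set (subsetP sC) // (subset_trans (subsetIr _ _)).
    have [S [sS zS nS]] := represented_dep rep sy (depC y yC yA).
    have sSC : S \subset C.
      by apply: subset_trans sS _; rewrite subUset sub1set yC subsetIr.
    have yS : y \in S.
      apply: contraT => yS; case/negP: nS; apply/eqP.
      have /rep[_] := iA; apply=> //; apply/subsetP => x xS.
      have := subsetP sS x xS; rewrite !inE => /orP[/eqP xy|/andP[]//].
      by rewrite xy (negbTE yS) in xS.
    have <- : symdiff W S :\: C = W :\: C.
      apply/setP => x; rewrite !inE; case: (boolP (x \in C)) => //= xC.
      by rewrite (negbTE (contra (subsetP sSC x) xC)) addbF.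
    apply: IH; last exact: zD.
      rewrite ltnS in ltn; apply: leq_trans ltn; rewrite proper_card //.
      rewrite properE; apply/andP; split.
        apply/subsetP => x; rewrite !inE => /andP[xA]; rewrite xA /=.
        case: (boolP (x \in S)) => [xS _|_]; last by rewrite addbF.
        have := subsetP sS x xS; rewrite !inE (negbTE xA) /= orbF => /eqP->//.
      by apply/subsetPn; exists y; rewrite !inE ?yA ?yW ?yS.
    apply/subsetP => x; rewrite !inE.
    case: (boolP (x \in S)) => [/(subsetP sSC)->|_]; first by rewrite orbT.
    by rewrite addbF => /(subsetP sW); rewrite inE.
  move=> S sS /existsP[Y /andP[sY zSY]].
  have := key _ _ (ltnSn _) _ zSY; rewrite setUSS // => /(_ isT) H.
  apply/eqP; rewrite -subset0 -H subsetD subsetUl /=.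
  rewrite -setI_eq0; apply/eqP/setP => x; rewrite !inE.
  apply/negP => /andP[/(subsetP sS)/(subsetP sI)]; rewrite inE => /andP[/negP].
  by [].
case=> sI noZ.
have [|BC /maxsetP[/andP[iBC sBC] mBC] _] := @maxset_exists _ (fun J => indep M J && (J \subset C)) set0.
  by rewrite indep0 sub0set.
have iU : indep M (I :|: BC).
  apply/rep; split.
    rewrite subUset (subset_trans sI (subsetDl _ _)).
    exact: subset_trans sBC sC.
  move=> S sS zS.
  have S0 : S :\: C = set0.
    apply: noZ.
      apply/subsetP => x; rewrite inE => /andP[xC /(subsetP sS)]; rewrite inE => /orP[//|].
      by move/(subsetP sBC); rewrite (negbTE xC).
    by apply/existsP; exists (S :&: C); rewrite subsetIr setUC setID.
  have /rep[_] := iBC; apply=> //; apply/subsetP => x xS.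
  have : x \in C by apply: contraT => xC; rewrite -[false](in_set0 x) -S0 inE xC.
  have := subsetP sS x xS; rewrite inE => /orP[/(subsetP sI)|//].
  by rewrite inE => /andP[/negbTE->].
have [B' bB' sB'] := maxset_exists iU.
have {}bB' : basis M B' by [].
apply/andP; split=> //; apply/existsP; exists (ground M :\: C :\: B').
rewrite disjoint_sym disjoints_subset; apply/andP; split; last first.
  apply/subsetP => x; rewrite !inE => /andP[xB _]; apply: contra xB => xI.
  by apply: (subsetP sB'); rewrite inE xI.
apply/basisP; split; first exact: basis_codelete.
move=> J /codelete_sub[A bA /subset_leq_card leJ]; apply: leq_trans leJ _.
have := card_codelete sC bA; have := card_codelete sC bB'; rewrite (card_basis bB' bA).
suff : (#|A :&: C| <= #|B' :&: C|)%N by card_lia.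
apply: (@leq_trans #|BC|); last first.
  by rewrite subset_leq_card // subsetI sBC (subset_trans _ sB') // subsetUr.
rewrite leqNgt; apply/negP => lt.
have [iA _] := basisP _ _ bA.
have [e] := indep_aug iBC (indep_sub (subsetIl A C) iA) lt.
rewrite !inE => /and3P[eBC eA eC] ie.
have := mBC (e |: BC); rewrite ie subUset sub1set eC sBC subsetUr => /(_ isT isT).
by move/setP/(_ e); rewrite setU11 (negbTE eBC).
Qed.

End CycleSpaces.

(** * Column vectors of signed graphs with a blocking pair *)

Local Open Scope ring_scope.

Lemma F2_cases (x : 'F_2) : x = 0 \/ x = 1.
Proof. by have [->|/F2_neq0->] := eqVneq x 0; [left | right]. Qed.

Lemma F2_addxx (x : 'F_2) : x + x = 0.
Proof. by have [->|->] := F2_cases x; apply: val_inj. Qed.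

Lemma F2_add_self (V : lmodType 'F_2) (x : V) : x + x = 0.
Proof.
by rewrite -[x]scale1r -scalerDl F2_addxx scale0r.
Qed.

Lemma F2_opp (V : lmodType 'F_2) (x : V) : - x = x.
Proof. by apply/eqP; rewrite eq_sym -addr_eq0 F2_add_self. Qed.

Lemma F2_add_eq0 (V : lmodType 'F_2) (x y : V) : (x + y == 0) = (x == y).
Proof. by rewrite addr_eq0 F2_opp. Qed.

Section ZeroSums.

Variables (T : finType) (V : vectType 'F_2).
Implicit Types (f : T -> V) (S : {set T}).

Definition zero_sum f : pred {set T} := fun S => \sum_(e in S) f e == 0.

Lemma sum_symdiff f A B :
  \sum_(e in symdiff A B) f e = \sum_(e in A) f e + \sum_(e in B) f e.
Proof.
rewrite [LHS]big_mkcond [X in _ = X + _]big_mkcond [X in _ = _ + X]big_mkcond -big_split; apply: eq_bigr => e _; rewrite inE /=.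
by case: (e \in A); case: (e \in B); rewrite /= ?addr0 ?add0r ?F2_add_self.
Qed.

Lemma zero_sum_space f : cycle_space (zero_sum f).
Proof.
split=> [|A B /eqP zA /eqP zB]; rewrite /zero_sum ?big_set0 //.
by rewrite sum_symdiff zA zB addr0.
Qed.

Lemma zero_sum_setU1 f S e : e \notin S ->
  zero_sum f (e |: S) = (\sum_(x in S) f x == f e).
Proof. by move=> eS; rewrite /zero_sum big_setU1 //= F2_add_eq0 eq_sym. Qed.

Lemma represented_vector f S : represented (vector_matroid f S) (zero_sum f).
Proof.
move=> I; rewrite /= /vector_indep; split=> [/andP[-> /F2_free H]|[-> H]].
  by split=> // X sX /eqP; apply: H.
by apply/F2_free => X sX /eqP; apply: H.
Qed.

End ZeroSums.

Definition eps n (a : option 'I_n) : 'rV['F_2]_n :=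
  if a is Some i then delta_mx 0 i else 0.

(* With [F_2^2] spanned by the odd loop [w] and the edge [uv], and [eps a] the edge
   from [u] to [a], these are the columns available to a signed graph whose odd
   edges all meet [u] or [v]. *)
Definition block_vector n (x : 'rV['F_2]_(2 + n)) : Prop :=
  exists a b : option 'I_n, rsubmx x = eps a + eps b /\ (lsubmx x = 0 \/ b = None).

Lemma eps_coord n (a : option 'I_n) i : eps a 0 i = (a == Some i)%:R.
Proof.
case: a => [j|]; rewrite mxE ?eqxx //=; congr (_%:R); congr nat_of_bool.
by rewrite eq_sym; apply/eqP/eqP => [->|[]].
Qed.

(** Contracting [x0] clears a coordinate [k] in which [x0] is 1. If [x0] lies in [F_2^2], any such
    [k] works. Otherwise [x0] is [(t, e_i + eps b)] and [k] is the coordinate of [i]: the operation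
    renames [i] to [b] in the vectors that use [i], and if [t] is nonzero then [b = None], so the
    shape is kept. *)
Lemma block_vector_contract n (x0 : 'rV['F_2]_(2 + n)) : block_vector x0 -> x0 != 0 ->
  exists2 k, x0 0 k = 1 & forall x, block_vector x -> block_vector (x + x 0 k *: x0).
Proof.
move=> [a [b [hx0 tx0]]] nx0.
have [h0|nh] := eqVneq (rsubmx x0) 0.
  have /rV0Pn[i /F2_neq0 Hi] : lsubmx x0 != 0.
    by apply: contraNneq nx0 => t0; rewrite -[x0]hsubmxK t0 h0 row_mx0.
  rewrite mxE in Hi; exists (lshift n i) => // x [c [d [hx tx]]].
  exists c, d; split.
    by rewrite linearD linearZ /= h0 scaler0 addr0.
  case: tx => [t0|->]; [left | by right].
  rewrite linearD /= t0 add0r linearZ /=.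
  have -> : x 0 (lshift n i) = lsubmx x 0 i by rewrite mxE.
  by rewrite t0 mxE scale0r.
have {a b hx0 tx0 nh} [i [b [hx0 nb tx0]]] : exists i b,
    [/\ rsubmx x0 = eps (Some i) + eps b, b != Some i & lsubmx x0 = 0 \/ b = None].
  have nab : a != b by apply: contraNneq nh => ab; rewrite hx0 ab F2_add_self.
  case: a hx0 nab => [i|] hx0 nab; first by exists i, b; rewrite eq_sym.
  case: b hx0 nab tx0 => [j|] // hx0 _ [t0|//].
  by exists j, None; split; rewrite ?hx0 1?addrC //; left.
have ck (x : 'rV_(2 + n)) : x 0 (rshift 2 i) = rsubmx x 0 i by rewrite mxE.
exists (rshift 2 i).
  by rewrite ck hx0 mxE !eps_coord (negbTE nb) eqxx addr0.
move=> x bx; have [c [d [hx tx]]] := bx.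
have [->|x1] := F2_cases (x 0 (rshift 2 i)); first by rewrite scale0r addr0.
rewrite x1 scale1r; move: x1; rewrite ck hx mxE !eps_coord.
have dbl (y z : 'rV['F_2]_n) : y + z + y = z by rewrite addrAC F2_add_self add0r.
case: eqVneq => [ca|nca]; case: eqVneq => [da|nda]; rewrite ?addr0 //= => _.
- have e1 : rsubmx (x + x0) = eps d + eps b.
    by rewrite linearD /= hx hx0 ca addrA dbl.
  case: tx0 => [t0|b0]; last by exists d, b; split=> //; right.
  exists b, d; split; first by rewrite e1 addrC.
  by case: tx => [t|->]; [left; rewrite linearD /= t t0 addr0 | right].
- have e1 : rsubmx (x + x0) = eps c + eps b.
    by rewrite linearD /= hx hx0 da [eps c + _]addrC addrA dbl.
  exists c, b; split=> //; case: tx0 => [t0|->]; [left | by right].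
  by case: tx => [t|]; [rewrite linearD /= t t0 addr0 | rewrite da].
Qed.

(** * Minors of matroids represented by block vectors *)

Section Minors.

Variable T : finType.
Implicit Types (M : matroid T) (Z : pred {set T}) (C D E S X Y : {set T}).

Lemma contract_cyclesU1 Z C c X : c \notin C ->
  contract_cycles Z (c |: C) X = contract_cycles Z C X || contract_cycles Z C (c |: X).
Proof.
move=> cC; apply/existsP/orP => [[Y /andP[sY zY]]|[] /existsP[Y /andP[sY zY]]].
- have [cY|cY] := boolP (c \in Y); [right | left]; apply/existsP.
    exists (Y :\ c); rewrite subDset sY /= (_ : _ :|: _ = X :|: Y) //.
    by rewrite -setUA setUCA setD1K.
  exists Y; rewrite zY andbT; apply/subsetP => y yY.
  by have := subsetP sY y yY; rewrite !inE => /orP[/eqP yc|//]; rewrite -yc yY in cY.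
- by exists Y; rewrite zY (subset_trans sY (subsetUr _ _)).
- exists (c |: Y); rewrite setUS //= (_ : _ :|: _ = c |: X :|: Y) //.
  by rewrite setUCA setUA.
Qed.

(** If [g c = 0] then [c] is a loop and [g] itself serves. Otherwise pivot on [k]: a set with sum
    [s] gets the sum [s + s_k g(c)], and as [g(c)_k = 1] this vanishes exactly when [s] is [0] or
    [g c]. *)
Lemma zero_sum_contract1 n (g : T -> 'rV['F_2]_(2 + n)) E c : c \in E ->
  (forall e, e \in E -> block_vector (g e)) ->
  exists2 g' : T -> 'rV['F_2]_(2 + n), forall e, e \in E -> block_vector (g' e) &
    forall X, c \notin X -> zero_sum g' X = zero_sum g X || zero_sum g (c |: X).
Proof.
move=> cE bg; have [gc0|gcn] := eqVneq (g c) 0.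
  by exists g => // X cX; rewrite zero_sum_setU1 // gc0 orbb.
have [k gk bk] := block_vector_contract (bg c cE) gcn.
exists (fun e => g e + g e 0 k *: g c) => [e eE|X cX]; first exact/bk/bg.
rewrite zero_sum_setU1 // /zero_sum big_split /= -scaler_suml -summxE.
set s := \sum_(e in X) g e; have [s0|s1] := F2_cases (s 0 k).
  rewrite s0 scale0r addr0; case: (eqVneq s (g c)) => [sc|_]; last by rewrite orbF.
  by rewrite sc gk in s0; move/eqP: s0; rewrite oner_eq0.
rewrite s1 scale1r F2_add_eq0; case: (eqVneq s 0) => //= s0.
by rewrite s0 mxE in s1; move/eqP: s1; rewrite eq_sym oner_eq0.
Qed.

Lemma zero_sum_contract n (g : T -> 'rV['F_2]_(2 + n)) E C : C \subset E ->
  (forall e, e \in E -> block_vector (g e)) ->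
  exists2 g' : T -> 'rV['F_2]_(2 + n), forall e, e \in E -> block_vector (g' e) &
    forall X, [disjoint X & C] -> zero_sum g' X = contract_cycles (zero_sum g) C X.
Proof.
move=> sC bg; have [m] := ubnP #|C|; elim: m C sC => // m IH C sC leC.
have [->|/set0Pn[c cC]] := eqVneq C set0.
  exists g => // X _; apply/idP/existsP => [zX|[Y]].
    by exists set0; rewrite sub0set setU0.
  by rewrite subset0 => /andP[/eqP->]; rewrite setU0.
have [||g1 bg1 zg1] := IH (C :\ c).
- by rewrite subDset (subset_trans sC (subsetUr _ _)).
- by rewrite (cardsD1 c) cC ltnS in leC.
have [g2 bg2 zg2] := zero_sum_contract1 (subsetP sC c cC) bg1.
exists g2 => // X dX; have cX : c \notin X by rewrite (disjointFl dX cC).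
have dX1 : [disjoint X & C :\ c] by apply: disjointWr dX; apply: subsetDl.
have dX2 : [disjoint c |: X & C :\ c].
  rewrite -setI_eq0 setIUl setU_eq0 !setI_eq0 dX1 andbT.
  by rewrite disjoints1 !inE eqxx.
by rewrite zg2 // !zg1 // -contract_cyclesU1 ?setD1K // !inE eqxx.
Qed.

(** The vector form of [even_cycle_with_blocking_pair]; both implications are proved below. *)
Definition block_represented M := exists n (g : T -> 'rV['F_2]_(2 + n)),
  (forall e, e \in ground M -> block_vector (g e)) /\ represented M (zero_sum g).

(** Only single-element minors need explicit vectors. If [C] contains some [e], start from those for
    the contraction of [e] and contract the rest by [zero_sum_contract]; if [C] is empty, start from
    the deletion of some [e] in [D]. Further deletions only restrict the vectors. *)
Lemma block_represented_minor M Z : cycle_space Z -> represented M Z ->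
  (forall e, e \in ground M -> exists n (g : T -> 'rV['F_2]_(2 + n)),
     (forall x, x \in ground M :\ e -> block_vector (g x)) /\
     (forall X, X \subset ground M :\ e -> zero_sum g X = Z X)) ->
  (forall e, e \in ground M -> exists n (g : T -> 'rV['F_2]_(2 + n)),
     (forall x, x \in ground M :\ e -> block_vector (g x)) /\
     (forall X, X \subset ground M :\ e -> zero_sum g X = Z X || Z (e |: X))) ->
  forall C D, C \subset ground M -> D \subset ground M -> [disjoint C & D] ->
    C :|: D != set0 -> block_represented (delete (contract M C) D).
Proof.
move=> cZ rep Hdel Hcon C D sC sD dCD nCD.
have rep' := represented_delete D (represented_contract cZ sC rep).
suff [n [g [bg zg]]] : exists n (g : T -> 'rV['F_2]_(2 + n)),
    (forall x, x \in ground M :\: C :\: D -> block_vector (g x)) /\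
    (forall X, X \subset ground M :\: C :\: D -> zero_sum g X = contract_cycles Z C X).
  by exists n, g; split=> //; apply: eq_represented rep' => S /zg.
have [C0|/set0Pn[e eC]] := eqVneq C set0; last first.
  have eM := subsetP sC e eC; have [n [g [bg zg]]] := Hcon e eM.
  have sCe : C :\ e \subset ground M :\ e by rewrite setSD.
  have [g' bg' zg'] := zero_sum_contract sCe bg.
  exists n, g'; split=> [x|X sX].
    rewrite !inE => /and3P[_ xC xM]; apply: bg'; rewrite !inE xM andbT.
    by apply: contraNneq xC => ->.
  have [sXM dXC _] : [/\ X \subset ground M, [disjoint X & C] & [disjoint X & D]].
    by move: sX; rewrite !subsetD => /andP[/andP[]].
  have eX : e \notin X by rewrite (disjointFl dXC eC).
  rewrite zg'; last by apply: disjointWr dXC; apply: subsetDl.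
  rewrite -{2}(setD1K eC) contract_cyclesU1 ?setD11 //.
  have sub Y : Y \subset C :\ e -> X :|: Y \subset ground M :\ e.
    move=> sY; rewrite subUset (subset_trans sY sCe) andbT.
    by rewrite subsetD sXM disjoint_sym disjoints1 eX.
  apply/existsP/orP => [[Y /andP[sY]]|].
    rewrite zg ?sub // => /orP[zY|zY]; [left | right]; apply/existsP; exists Y.
      by rewrite sY.
    by rewrite sY -setUA.
  by case=> /existsP[Y /andP[sY zY]]; exists Y; rewrite sY zg ?sub // ?zY // setUA zY orbT.
have [e eD] : exists e, e \in D by apply/set0Pn; rewrite C0 set0U in nCD.
have eM := subsetP sD e eD; have [n [g [bg zg]]] := Hdel e eM.
have sX X : X \subset ground M :\: C :\: D -> X \subset ground M :\ e.
  move=> sX; apply: subset_trans sX _; rewrite C0 setD0.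
  by apply: setDS; rewrite sub1set.
exists n, g; split=> [x xE|X /sX sXe].
  by apply: bg; rewrite -sub1set sX // sub1set.
rewrite zg // C0; apply/idP/existsP => [zX|[Y]].
  by exists set0; rewrite sub0set setU0.
by rewrite subset0 => /andP[/eqP->]; rewrite setU0.
Qed.

End Minors.

(** * Signed graphs and block vectors *)

Lemma indep_imset (T U : finType) (M : matroid T) (Z : pred {set T}) (f : U -> T)
    (I : {set U}) : injective f -> represented M Z -> f @: I \subset ground M ->
  indep M (f @: I) <-> forall S : {set U}, S \subset I -> Z (f @: S) -> S = set0.
Proof.
move=> injf rep sI; split=> [/rep[_ H] S sS zS|H].
  by have /eqP := H _ (imsetS f sS) zS; rewrite imset_eq0 => /eqP.
apply/rep; split=> // S sS zS.
have eS : S = f @: (f @^-1: S).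
  apply/setP => x; apply/idP/imsetP => [xS|[y]]; last by rewrite inE => yS ->.
  by have /imsetP[y yI xy] := subsetP sS x xS; exists y; rewrite // inE -xy.
rewrite eS (H (f @^-1: S)) ?imset0 // -?eS //.
apply/subsetP => y; rewrite inE => /(subsetP sS)/imsetP[z zI /injf ->] //.
Qed.

Section EvenCycleColumns.

Variable G : graph.
Implicit Types (W S : {set edge G}) (u v : vertex G).

Definition even_cycle_col W (e : edge G) :=
  col (enum_rank e) (col_mx (char_row W) (incidence_mx G)).

Lemma ends_pair (e : edge G) : exists a b, ends e = [set a; b].
Proof.
have := ends_card e; case/andP; rewrite leq_eqVlt => /orP[|].
  by rewrite eq_sym => /cards1P[a ->] _; exists a, a; rewrite setUid.
move=> gt1 le2; have /cards2P[a [b [_ ->]]] : #|ends e| == 2 by rewrite eqn_leq le2.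
by exists a, b.
Qed.

Lemma zero_sum_even_cycle_col W S :
  zero_sum (even_cycle_col W) S =
  (\sum_(e in S) (e \in W)%:R == 0 :> 'F_2) && zero_sum (@inc_col G) S.
Proof.
rewrite /zero_sum.
have -> : \sum_(e in S) even_cycle_col W e =
    col_mx (\sum_(e in S) col (enum_rank e) (char_row W)) (\sum_(e in S) inc_col e).
  elim/big_rec3: _ => [|e x y z _ ->]; first by rewrite col_mx0.
  by rewrite -add_col_mx /even_cycle_col col_col_mx.
rewrite col_mx_eq0; congr (_ && _).
have -> : (\sum_(e in S) col (enum_rank e) (char_row W)) =
   (\sum_(e in S) (e \in W)%:R : 'F_2)%:M.
  apply/matrixP => i j; rewrite !ord1 summxE mxE mulr1n.
  by apply: eq_bigr => e _; rewrite !mxE enum_rankK.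
apply/eqP/eqP => [/matrixP/(_ 0 0)|->]; last by apply/matrixP => i j; rewrite !mxE mul0rn.
by rewrite !mxE mulr1n.
Qed.

Lemma inc_col_coord (e : edge G) (x a b : vertex G) : ends e = [set a; b] ->
  inc_col e (enum_rank x) 0 = (a == x)%:R + (b == x)%:R.
Proof.
move=> /inc_colE->; rewrite !mxE !(inj_eq enum_rank_inj) !eqxx !andbT.
by rewrite ![_ == x]eq_sym.
Qed.

Lemma inc_col_sum (e : edge G) : \sum_i inc_col e i 0 = 0.
Proof.
have [a [b /inc_colE->]] := ends_pair e.
rewrite (eq_bigr (fun i => (i == enum_rank a)%:R + (i == enum_rank b)%:R)); last first.
  by move=> i _; rewrite !mxE !andbT.
have H (k : 'I_#|vertex G|) : \sum_i (i == k)%:R = 1 :> 'F_2.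
  by rewrite (bigD1 k) //= eqxx big1 ?addr0 // => i /negbTE->.
by rewrite big_split /= !H; apply: val_inj.
Qed.

Lemma zero_sum_inc_colP u S :
  reflect (forall x, x != u -> \sum_(e in S) inc_col e (enum_rank x) 0 = 0)
          (zero_sum (@inc_col G) S).
Proof.
apply: (iffP eqP) => [S0 x _|H]; first by rewrite -summxE S0 mxE.
have Hx i : i != enum_rank u -> (\sum_(e in S) inc_col e) i 0 = 0.
  move=> iu; rewrite summxE -(enum_valK i); apply: H.
  by apply: contraNneq iu => <-; rewrite enum_valK.
apply/matrixP => i j; rewrite !ord1 [RHS]mxE.
have [->|/Hx//] := eqVneq i (enum_rank u).
have : \sum_i (\sum_(e in S) inc_col e) i 0 = 0.
  rewrite (eq_bigr (fun i => \sum_(e in S) inc_col e i 0)); last by move=> k _; rewrite summxE.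
  by rewrite exchange_big big1 // => e _; apply: inc_col_sum.
by rewrite (bigD1 (enum_rank u)) //= [X in _ + X]big1 ?addr0.
Qed.

(** Resigning at [u] adds the incidence row of [u] to the row of [W], and that row sums to zero over
    any set on which the incidence part vanishes. *)
Lemma zero_sum_resign W u S :
  zero_sum (even_cycle_col (resign W u)) S = zero_sum (even_cycle_col W) S.
Proof.
rewrite !zero_sum_even_cycle_col; case: (boolP (zero_sum _ S)); rewrite ?andbF //.
move=> /eqP S0; rewrite !andbT; congr (_ == 0).
have Su : \sum_(e in S) inc_col e (enum_rank u) 0 = 0 by rewrite -summxE S0 mxE.
rewrite -[RHS]addr0 -[X in _ = _ + X]Su -big_split; apply: eq_bigr => e _ /=.
have sE : (e \in star u) = ((u \in ends e) && (#|ends e| == 2)).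
  by rewrite inE mxE !enum_rankK; case: (_ && _).
rewrite in_setU !in_setD sE !mxE !enum_rankK.
by case: (e \in W); case: (u \in ends e); case: (#|ends e| == 2);
  rewrite /= ?addr0 ?add0r ?F2_add_self //; apply: val_inj.
Qed.

Lemma zero_sum_resigns W us S :
  zero_sum (even_cycle_col (foldl (@resign G) W us)) S = zero_sum (even_cycle_col W) S.
Proof. by elim: us W => //= u us IH W; rewrite IH zero_sum_resign. Qed.

(** The row of [u] is dropped, the rows of [W] and [v] form the [F_2^2] part, and the remaining
    vertices index [F_2^n]. An edge avoiding both [u] and [v] is even, so its [F_2^2] part is zero;
    any other edge uses at most one further vertex. *)
Lemma block_vector_of_graph W u v : u != v ->
  (forall e, e \in W -> (u \in ends e) || (v \in ends e)) ->
  exists n (g : edge G -> 'rV['F_2]_(2 + n)),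
    (forall e, block_vector (g e)) /\
    (forall S, zero_sum g S = zero_sum (even_cycle_col W) S).
Proof.
move=> nuv blW; pose n := #|vertex G|.
pose t e : 'rV['F_2]_2 :=
  \row_i (if i == 0 then (e \in W)%:R else inc_col e (enum_rank v) 0).
(* The rows of [u] and [v] are set to zero rather than removed, which lets all vertices index the
   coordinates. *)
pose h e : 'rV['F_2]_n :=
  \row_j (if enum_val j \in [:: u; v] then 0 else inc_col e j 0).
exists n, (fun e => row_mx (t e) (h e)); split=> [e|S].
  have [a [b eab]] := ends_pair e.
  pose eta (x : vertex G) : option 'I_n := if x \in [:: u; v] then None else Some (enum_rank x).
  have hE : h e = eps (eta a) + eps (eta b).
    apply/rowP => j; rewrite [LHS]mxE [RHS]mxE !eps_coord.
    rewrite -[inc_col e j 0](congr1 (fun k => inc_col e k 0) (enum_valK j)).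
    rewrite (inc_col_coord _ eab).
    have etaE x : (eta x == Some j) = (enum_val j \notin [:: u; v]) && (x == enum_val j).
      rewrite /eta; case: ifP => xU.
        by case: (x =P enum_val j) => [<-|_]; rewrite ?xU ?andbF.
      have -> : (Some (enum_rank x) == Some j) = (x == enum_val j).
        by apply/eqP/eqP => [[<-]|->]; rewrite ?enum_rankK ?enum_valK.
      by case: (x =P enum_val j) => [<-|_]; rewrite ?xU ?andbF.
    by rewrite !etaE; case: ifP => _ //=; rewrite addr0.
  rewrite /block_vector row_mxKl row_mxKr.
  have [aU|aU] := boolP (a \in [:: u; v]).
    by exists (eta b), None; split; [rewrite hE /eta aU addrC | right].
  exists (eta a), (eta b); split=> //; rewrite [in X in _ \/ X]/eta.
  have [bU|bU] := boolP (b \in [:: u; v]); [by right | left].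
  move: aU bU; rewrite !inE !negb_or => /andP[au av] /andP[bu bv].
  apply/rowP => i; rewrite [LHS]mxE [RHS]mxE; case: eqP => _.
    case: (boolP (e \in W)) => // /blW; rewrite eab !inE.
    by rewrite ![u == _]eq_sym ![v == _]eq_sym (negbTE au) (negbTE av) (negbTE bu) (negbTE bv).
  by rewrite (inc_col_coord v eab) (negbTE av) (negbTE bv) addr0.
rewrite zero_sum_even_cycle_col /zero_sum.
have -> : \sum_(e in S) row_mx (t e) (h e) = row_mx (\sum_(e in S) t e) (\sum_(e in S) h e).
  elim/big_rec3: _ => [|e x y z _ ->]; first by rewrite row_mx0.
  by rewrite add_row_mx.
rewrite row_mx_eq0; apply/andP/andP => [[/eqP t0 /eqP h0]|[/eqP w0 /(zero_sum_inc_colP u) d0]].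
  split.
    apply/eqP; move/rowP/(_ 0): t0; rewrite summxE mxE => t0; rewrite -[RHS]t0; apply: eq_bigr => e _.
    by rewrite mxE eqxx.
  apply/(zero_sum_inc_colP u) => x xu; have [->|xv] := eqVneq x v.
    move/rowP/(_ 1): t0; rewrite summxE mxE => t0; rewrite -[RHS]t0; apply: eq_bigr => e _.
    by rewrite [RHS]mxE.
  move/rowP/(_ (enum_rank x)): h0; rewrite summxE mxE => h0; rewrite -[RHS]h0; apply: eq_bigr => e _.
  by rewrite [RHS]mxE enum_rankK !inE (negbTE xu) (negbTE xv).
split; apply/eqP/rowP => i; rewrite summxE mxE.
  have [->|i0] := eqVneq i 0.
    by rewrite -[RHS]w0; apply: eq_bigr => e _; rewrite mxE.
  rewrite -[RHS](d0 v) 1?eq_sym //; apply: eq_bigr => e _.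
  by rewrite [LHS]mxE (negbTE i0).
have [iU|iU] := boolP (enum_val i \in [:: u; v]).
  by rewrite big1 // => e _; rewrite mxE iU.
rewrite -[RHS](d0 (enum_val i)); last by move: iU; rewrite !inE negb_or => /andP[].
by apply: eq_bigr => e _; rewrite [LHS]mxE (negbTE iU) enum_valK.
Qed.

End EvenCycleColumns.

Lemma block_represented_of_even_cycle (T : finType) (M : matroid T) :
  even_cycle_with_blocking_pair M -> block_represented M.
Proof.
case=> G [W [[f [injf imf isoM]] [u [v [nuv [us bl]]]]]].
have [n [g [bg zg]]] := block_vector_of_graph nuv bl.
(* The isomorphism lives on the subtype of ground elements; outside it the vectors get the default
   value 0. *)
pose g' (x : T) : 'rV['F_2]_(2 + n) :=
  if insub x is Some y then g (f y) else 0.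
exists n, g'; split=> [e eM|I]; first by rewrite /g' insubT.
have repG := represented_vector (even_cycle_col W) [set: edge G].
suff H (I' : {set {x | x \in ground M}}) : indep M (val @: I') <->
    forall S : {set {x | x \in ground M}}, S \subset I' -> zero_sum g' (val @: S) -> S = set0.
  split=> [iI|[sI HI]].
    have sI := indep_ground iI; split=> // S sS zS.
    have eX (X : {set T}) : X \subset ground M ->
        X = val @: [set x : {x | x \in ground M} | val x \in X].
      move=> sX; apply/setP => x; apply/idP/imsetP => [xX|[y]]; last by rewrite inE => yX ->.
      by exists (exist _ x (subsetP sX x xX)); rewrite ?inE.
    have sS' := subset_trans sS sI.
    have S0 : [set x : {x | x \in ground M} | val x \in S] = set0.
      have /H HS : indep M (val @: [set x : {x | x \in ground M} | val x \in I]) by rewrite -eX.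
      apply: HS; last by rewrite -eX.
      by apply/subsetP => x; rewrite !inE => /(subsetP sS).
    by rewrite (eX S sS') S0 imset0.
  have eI : I = val @: [set x : {x | x \in ground M} | val x \in I].
    apply/setP => x; apply/idP/imsetP => [xX|[y]]; last by rewrite inE => yX ->.
    by exists (exist _ x (subsetP sI x xX)); rewrite ?inE.
  rewrite eI; apply/H => S sS zS.
  have := HI _ _ zS; rewrite eI imsetS // => /(_ isT) /eqP.
  by rewrite imset_eq0 => /eqP.
rewrite isoM (indep_imset injf repG) ?subsetT //.
have eZ (S : {set {x | x \in ground M}}) :
    zero_sum g' (val @: S) = zero_sum (even_cycle_col W) (f @: S).
  rewrite -(zero_sum_resigns W us) -zg /zero_sum !big_imset /=; last 2 first.
  - by move=> x y _ _; apply: injf.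
  - by move=> x y _ _; apply: val_inj.
  by congr (_ == 0); apply: eq_bigr => x _; rewrite /g' valK.
by split=> H S sS; [rewrite eZ | rewrite -eZ]; apply: H.
Qed.

(** The vertices are [u = None], [v = Some None] and one [Some (Some i)] per coordinate. An element
    with indices [a], [b] becomes an edge between [a] and [b], with [None] read as [u], except that
    the second end is [v] when the second coordinate of the [F_2^2] part is 1, in which case
    [b = None]. The first coordinate decides parity, so odd edges have [b = None] and meet [u] or
    [v] without any resigning. *)
Lemma even_cycle_of_block_represented (T : finType) (M : matroid T) :
  block_represented M -> even_cycle_with_blocking_pair M.
Proof.
case=> n [g [bg rep]].
pose E := {x : T | x \in ground M}; pose V := option (option 'I_n).
have /fin_all_exists[ab abP] (e : E) : exists ab : option 'I_n * option 'I_n,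
    rsubmx (g (val e)) = eps ab.1 + eps ab.2 /\ (lsubmx (g (val e)) = 0 \/ ab.2 = None).
  by have [a [b H]] := bg _ (valP e); exists (a, b).
pose vx (a : option 'I_n) : V := omap Some a.
pose tl (e : E) : V :=
  if lsubmx (g (val e)) 0 1 == 0 then vx (ab e).2 else Some None.
pose ends e : {set V} := [set vx (ab e).1; tl e].
have endsP e : (0 < #|ends e| <= 2)%N by rewrite cards2; case: (_ != _).
pose G := @Graph V E ends endsP.
pose W : {set edge G} := [set e : E | lsubmx (g (val e)) 0 0 != 0].
have colv (e : edge G) : inc_col e (enum_rank (Some None : vertex G)) 0 = lsubmx (g (val e)) 0 1.
  rewrite (@inc_col_coord G e _ _ _ (erefl _)) /tl; have [_ tb] := abP e.
  have nv a : (vx a == Some None :> V) = false by case: a.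
  rewrite nv add0r; case: ifP => [/eqP->|/negbT/F2_neq0->]; first by rewrite nv.
  by rewrite eqxx.
have colx (e : edge G) i : inc_col e (enum_rank (Some (Some i) : vertex G)) 0 = rsubmx (g (val e)) 0 i.
  rewrite (@inc_col_coord G e _ _ _ (erefl _)) /tl; have [-> tb] := abP e.
  have nv a : (vx a == Some (Some i) :> V) = (a == Some i) by case: a.
  rewrite [RHS]mxE !eps_coord nv; case: ifP => [_|/negbT t1]; first by rewrite nv.
  by case: tb => [t0|->]; [rewrite t0 mxE eqxx in t1 |].
have eZ (S : {set edge G}) : zero_sum g (val @: S) = zero_sum (even_cycle_col W) S.
  rewrite zero_sum_even_cycle_col /zero_sum big_imset /=; last by move=> x y _ _; apply: val_inj.
  have coordE k : (\sum_(e in S) g (val e)) 0 k = \sum_(e in S) g (val e) 0 k by rewrite summxE.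
  have Wsum : \sum_(e in S) (e \in W)%:R = \sum_(e in S) g (val e) 0 (lshift n 0) :> 'F_2.
    apply: eq_bigr => e _; rewrite inE mxE.
    by case: eqP => [->|/eqP/F2_neq0->].
  apply/eqP/andP => [g0|[/eqP w0 /(zero_sum_inc_colP (None : vertex G)) d0]].
    split; first by rewrite Wsum -coordE g0 mxE.
    apply/(zero_sum_inc_colP (None : vertex G)) => -[[i|]|] // _.
      rewrite (eq_bigr (fun e => g (val e) 0 (rshift 2 i))) => [|e _]; last by rewrite colx mxE.
      by rewrite -coordE g0 mxE.
    rewrite (eq_bigr (fun e => g (val e) 0 (lshift n 1))) => [|e _]; last by rewrite colv mxE.
    by rewrite -coordE g0 mxE.
  apply/rowP => k; rewrite coordE [RHS]mxE.
  case: (split_ordP k) => j ->; last first.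
    rewrite -[RHS](d0 (Some (Some j))) //; apply: eq_bigr => e _.
    by rewrite colx mxE.
  have [->|->] : j = 0 \/ j = 1 by case: j => [[|[|?]]] ? //; [left | right]; apply: val_inj.
    by rewrite -Wsum.
  by rewrite -[RHS](d0 (Some None)) //; apply: eq_bigr => e _; rewrite colv mxE.
exists G, W; split.
  exists id; split=> [x y //||I]; first by rewrite imset_id.
  have sI : val @: I \subset ground M by apply/subsetP => _ /imsetP[x _ ->]; apply: valP.
  rewrite imset_id; apply/idP/idP => [/(indep_imset val_inj rep sI) H|iI].
    apply/(represented_vector (even_cycle_col W) [set: edge G] I); split; first exact: subsetT.
    by move=> S sS; rewrite -eZ; apply: H.
  apply/(indep_imset val_inj rep sI) => S sS; rewrite eZ.
  by have /(represented_vector (even_cycle_col W) [set: edge G] I)[_] := iI; apply.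
exists None, (Some None); split=> //; exists [::] => e /=; rewrite !inE => t0.
have [_ [tb|tb]] := abP e; first by rewrite tb mxE eqxx in t0.
by rewrite /tl tb; case: ifP; rewrite /= ?eqxx ?orbT.
Qed.

(** * Counting cocycles *)

Lemma col_mulmx (F : fieldType) m n p (A : 'M[F]_(m, n)) (B : 'M[F]_(n, p)) j :
  col j (A *m B) = A *m col j B.
Proof. by rewrite !colE mulmxA. Qed.

Section Weights.

Variable m : nat.
Implicit Types (a b : 'rV['F_2]_m).

Definition supp a : {set 'I_m} := [set j | a 0 j != 0].

Definition col_supp p (A : 'M['F_2]_(p, m)) : {set 'I_m} := [set j | col j A != 0].

Lemma card_suppD a b :
  (#|supp (a + b)| + 2 * #|supp a :&: supp b| = #|supp a| + #|supp b|)%N.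
Proof.
have -> : supp (a + b) = (supp a :\: supp b) :|: (supp b :\: supp a).
  apply/setP => j; rewrite !inE mxE.
  have [->|->] := F2_cases (a 0 j); have [->|->] := F2_cases (b 0 j);
    by rewrite ?addr0 ?add0r ?F2_add_self ?eqxx ?oner_eq0.
rewrite cardsU (_ : _ :&: _ = set0); last first.
  by apply/setP => j; rewrite !inE; case: (a 0 j != 0); rewrite ?andbF.
have := cardsID (supp b) (supp a); have := cardsID (supp a) (supp b).
rewrite [supp b :&: _]setIC cards0; card_lia.
Qed.

(** Translation by a unit vector on which [c] takes the value 1 exchanges this set with its
    complement. *)
Lemma card_row_nonorthogonal d (c : 'cV['F_2]_d) : c != 0 ->
  (2 * #|[set v : 'rV['F_2]_d | ((v *m c) 0 0 != 0)%R]| = 2 ^ d)%N.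
Proof.
move=> /cV0Pn[i /F2_neq0 ci]; set S := [set v | _].
pose sh (v : 'rV['F_2]_d) := v + delta_mx 0 i.
have shK : involutive sh by move=> v; rewrite /sh -addrA F2_add_self addr0.
have sE v : (sh v \in S) = (v \notin S).
  rewrite !inE mulmxDl mxE -rowE [row i c 0 0]mxE ci.
  by have [->|->] := F2_cases ((v *m c) 0 0); rewrite ?add0r ?F2_add_self ?eqxx ?oner_eq0.
have -> : (2 ^ d = #|{: 'rV['F_2]_d}|)%N by rewrite card_mx card_Fp // mul1n.
rewrite -(cardsC S) mul2n -addnn; congr addn.
rewrite -(card_imset (mem S) (can_inj shK)); apply: eq_card => v.
rewrite inE -sE; apply/imsetP/idP => [[x xS ->]|vS]; first by rewrite shK.
by exists (sh v); rewrite ?shK.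
Qed.

(** Count the pairs [(v, j)] with [v *m B] nonzero at [j]: each nonzero column of [B] is met by
    exactly half of the [2^d] vectors [v], and each nonzero [v] contributes at least [w]. *)
Lemma weight_average d (B : 'M['F_2]_(d, m)) w :
  (forall v, v != 0%R -> w <= #|supp (v *m B)|)%N ->
  (2 * w * (2 ^ d - 1) <= 2 ^ d * #|col_supp B|)%N.
Proof.
move=> wB.
have cT : #|{: 'rV['F_2]_d}| = (2 ^ d)%N by rewrite card_mx card_Fp // mul1n.
have le1 : (w * (2 ^ d - 1) <= \sum_(v : 'rV['F_2]_d) #|supp (v *m B)|)%N.
  rewrite (bigD1 0) //=; apply: leq_trans (leq_addl _ _).
  apply: (@leq_trans (\sum_(v : 'rV['F_2]_d | v != 0%R) w)); last exact: leq_sum.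
  rewrite sum_nat_const mulnC leq_mul2r; apply/orP; right.
  by rewrite cardC1 cT subn1.
have eq2 : (2 * \sum_(v : 'rV['F_2]_d) #|supp (v *m B)| = 2 ^ d * #|col_supp B|)%N.
  have -> : (\sum_(v : 'rV['F_2]_d) #|supp (v *m B)| =
      \sum_(j < m) #|[set v : 'rV['F_2]_d | ((v *m col j B) 0 0 != 0)%R]|)%N.
    transitivity (\sum_(v : 'rV['F_2]_d) \sum_(j < m) ((v *m B) 0%R j != 0%R : nat))%N.
      by apply: eq_bigr => v _; rewrite cardsE -sum1_card big_mkcond.
    rewrite exchange_big; apply: eq_bigr => j _ /=.
    rewrite cardsE -sum1_card [RHS]big_mkcond; apply: eq_bigr => v _ /=.
    rewrite unfold_in -col_mulmx.
    by have -> : (col j (v *m B) 0 0 = (v *m B) 0 j) by rewrite mxE.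
  rewrite big_distrr /= cardsE -sum1_card [RHS]big_distrr /= [RHS]big_mkcond /=.
  apply: eq_bigr => j _; rewrite unfold_in; case: eqP => [->|/eqP /card_row_nonorthogonal->].
    rewrite (_ : [set v | _] = set0) ?cards0 //.
    by apply/setP => v; rewrite !inE mulmx0 mxE eqxx.
  by rewrite muln1.
by rewrite -eq2 -mulnA leq_mul2l le1 orbT.
Qed.

End Weights.

(** * Cocycle spaces as row spaces, and the counting inequalities *)

Section RepresentationMatrix.

Variables (T : finType) (E : {set T}).

(** Its row space is the cocycle space of the vectors on [E], padded by zero columns outside [E]. *)
Definition rep_mx p (g : T -> 'rV['F_2]_p) : 'M['F_2]_(p, #|T|) :=
  \matrix_(i, j) (if enum_val j \in E then g (enum_val j) 0 i else 0).

Lemma rep_mx_char p (g : T -> 'rV['F_2]_p) (c : 'cV['F_2]_#|T|) :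
  rep_mx g *m c = (\sum_(e in [set e in E | c (enum_rank e) 0 != 0]) g e)^T.
Proof.
apply/matrixP => i j; rewrite ord1 !mxE summxE [RHS]big_mkcond /=.
rewrite (reindex enum_rank) /=; last by exists enum_val => k _; rewrite ?enum_valK ?enum_rankK.
apply: eq_bigr => e _; rewrite mxE enum_rankK inE.
by have [->|->] := F2_cases (c (enum_rank e) 0); rewrite ?eqxx ?oner_eq0 ?andbF ?mulr0 ?mulr1 ?andbT //.
Qed.

(** The columns of the cokernel of [rep_mx f], restricted to [E], are characteristic vectors of
    zero-sum sets of [f]. These are zero-sum for [g] too, so [rep_mx g] kills the cokernel. *)
Lemma rep_mx_sub p q (f : T -> 'rV['F_2]_p) (g : T -> 'rV['F_2]_q) :
  (forall X : {set T}, X \subset E -> zero_sum f X -> zero_sum g X) ->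
  (rep_mx g <= rep_mx f)%MS.
Proof.
move=> H; rewrite submxE; apply/eqP/matrixP => i j.
have colE (A : 'M['F_2]_(q, #|T|)) : (A *m cokermx (rep_mx f)) i j = (A *m col j (cokermx (rep_mx f))) i 0.
  by rewrite -col_mulmx [RHS]mxE.
rewrite colE rep_mx_char.
set X := [set e in E | _]; suff /eqP-> : zero_sum g X by rewrite trmx0 !mxE.
apply: H; first by apply/subsetP => e; rewrite inE => /andP[].
apply/eqP/trmx_inj; rewrite -rep_mx_char -col_mulmx mulmx_coker trmx0.
by apply/matrixP => k l; rewrite !mxE.
Qed.

Lemma rep_mx_orthogonal p (g : T -> 'rV['F_2]_p) (X : {set T}) (v : 'rV['F_2]_#|T|) :
  X \subset E -> zero_sum g X -> (v <= rep_mx g)%MS -> \sum_(e in X) v 0 (enum_rank e) = 0.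
Proof.
move=> sX /eqP X0 /submxP[l ->].
pose c : 'cV['F_2]_#|T| := \col_j (enum_val j \in X)%:R.
have gc : rep_mx g *m c = 0.
  rewrite rep_mx_char (_ : [set e in E | _] = X) ?X0 ?trmx0 //.
  apply/setP => e; rewrite inE mxE enum_rankK.
  by case: (boolP (e \in X)) => [/(subsetP sX)->|_]; rewrite ?oner_eq0 ?eqxx ?andbF.
have : (l *m rep_mx g *m c) 0 0 = 0 by rewrite -mulmxA gc mulmx0 mxE.
rewrite mxE (reindex enum_rank) /=; last first.
  by exists enum_val => k _; rewrite ?enum_valK ?enum_rankK.
move=> s0; rewrite -[RHS]s0 [LHS]big_mkcond /=; apply: eq_bigr => e _.
by rewrite [c _ _]mxE enum_rankK; case: (e \in X); rewrite ?mulr1 ?mulr0.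
Qed.

Lemma rep_mx_rank p (g : T -> 'rV['F_2]_p) (I : {set T}) : I \subset E ->
  (forall S : {set T}, S \subset I -> zero_sum g S -> S = set0) -> (#|I| <= \rank (rep_mx g))%N.
Proof.
move=> sI indI; pose B : 'M['F_2]_(#|I|, p) := \matrix_i g (enum_val i).
have sB : (B <= (rep_mx g)^T)%MS.
  apply/row_subP => i; rewrite rowK; apply: (eq_row_sub (enum_rank (enum_val i))).
  by apply/rowP => k; rewrite !mxE enum_rankK (subsetP sI _ (enum_valP i)).
rewrite -mxrank_tr; apply: leq_trans (mxrankS sB).
suff /eqP-> : row_free B by [].
apply: inj_row_free => v vB.
have S0 : [set enum_val i | i in [set i | v 0 i != 0]] = set0.
  apply: indI; first by apply/subsetP => _ /imsetP[i _ ->]; apply: enum_valP.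
  rewrite /zero_sum big_imset /=; last by move=> x y _ _; apply: enum_val_inj.
  apply/eqP; rewrite -[RHS]vB mulmx_sum_row [LHS]big_mkcond /=; apply: eq_bigr => i _.
  by rewrite inE rowK; have [->|->] := F2_cases (v 0 i); rewrite ?eqxx ?oner_eq0 ?scale0r ?scale1r //.
apply/rowP => i; rewrite [RHS]mxE; apply/eqP; apply: contraT => vi.
by have := in_set0 (enum_val i); rewrite -S0 imset_f // inE.
Qed.

Lemma sum_eps n (a : option 'I_n) : \sum_i eps a 0 i = a%:R.
Proof.
case: a => [k|]; last by rewrite big1 // => i _; rewrite mxE.
by rewrite (bigD1 k) //= mxE !eqxx big1 ?addr0 // => i /negbTE ik; rewrite mxE ik.
Qed.

Lemma card_supp_eps n (a : option 'I_n) : #|supp (eps a)| = a :> nat.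
Proof.
case: a => [k|].
  transitivity #|[set k]|; last by rewrite cards1.
  apply: eq_card => i; rewrite !inE eps_coord (inj_eq Some_inj).
  by rewrite [i == k]eq_sym; case: (k == i).
by apply/eqP; rewrite cards_eq0; apply/eqP/setP => i; rewrite !inE mxE eqxx.
Qed.

(* [P] collects the two coordinates in [F_2^2], and [R] is the sum of the other
   rows, i.e. the star of [u]; an edge that avoids [u] and is not a loop lies in
   two of the other stars and in none of the rows of [col_mx P R]. *)
Lemma block_vector_count n (g : T -> 'rV['F_2]_(2 + n)) w :
  (forall e, e \in E -> block_vector (g e)) ->
  (forall v, (v <= rep_mx g)%MS -> v != 0%R -> w <= #|supp v|)%N ->
  exists (P : 'M['F_2]_(2, #|T|)) (R : 'rV['F_2]_#|T|) (k : nat),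
    let Y := col_mx P R in
    [/\ (Y <= rep_mx g)%MS,
        (\rank (rep_mx g) <= \rank Y + k.-1)%N,
        (w * k + 2 * #|col_supp Y| <= #|supp R| + 2 * #|E|)%N
      & (2 * w * (2 ^ \rank Y - 1) <= 2 ^ \rank Y * #|col_supp Y|)%N].
Proof.
move=> bg wA; pose A := rep_mx g; pose D := dsubmx A.
pose R := const_mx 1 *m D : 'rV_#|T|.
pose nz := [set a | row a D != 0].
exists (usubmx A), R, #|nz|; move=> Y.
have sD : (D <= A)%MS by rewrite -[X in (_ <= X)%MS](vsubmxK A) -addsmxE addsmxSr.
have sU : (usubmx A <= A)%MS by rewrite -[X in (_ <= X)%MS](vsubmxK A) -addsmxE addsmxSl.
have sY : (Y <= A)%MS by rewrite col_mx_sub sU (submx_trans (submxMl _ _)).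
have RE j : R 0 j = \sum_a D a j by rewrite mxE; apply: eq_bigr => a _; rewrite mxE mul1r.
split=> //.
- have [nz0|/set0Pn[b bnz]] := eqVneq nz set0.
    apply: leq_trans (mxrankS _) (leq_addr _ _).
    rewrite -[rep_mx g]vsubmxK col_mx_sub /Y -addsmxE addsmxSl.
    rewrite (_ : dsubmx _ = 0) ?sub0mx //; apply/row_matrixP => a; rewrite row0.
    by have := in_set0 a; rewrite -nz0 inE => /negbFE/eqP.
  (* The nonzero row [b] is recovered from [R] and the other rows; hence [k.-1] and not [k] in the
     rank bound. *)
  pose N := (\sum_(a in nz :\ b) <<row a D>>)%MS.
  have rN : (\rank N <= #|nz|.-1)%N.
    rewrite (cardsD1 b nz) bnz add1n /= -[leqRHS]sum1_card.
    apply: leq_trans (mxrank_sum_leqif _) _ => /=.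
    by apply: leq_sum => a _; rewrite genmxE rank_leq_row.
  have sN a : a != b -> (row a D <= Y + N)%MS.
    move=> ab; have [->|nza] := eqVneq (row a D) 0; first exact: sub0mx.
    apply: submx_trans (addsmxSr _ _); apply: (sumsmx_sup a).
      by rewrite !inE ab.
    by rewrite genmxE.
  have sR : (R <= Y + N)%MS.
    by apply: submx_trans (addsmxSl _ _); rewrite /Y -addsmxE addsmxSr.
  have sA : (A <= Y + N)%MS.
    rewrite -[A]vsubmxK col_mx_sub; apply/andP; split.
      by apply: submx_trans (addsmxSl _ _); rewrite /Y -addsmxE addsmxSl.
    apply/row_subP => a; have [->|/sN//] := eqVneq a b.
    have -> : row b D = R - \sum_(a | a != b) row a D.
      have -> : R = \sum_a row a D.
        by apply/rowP => j; rewrite RE summxE; apply: eq_bigr => c _; rewrite [RHS]mxE.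
      by rewrite (bigD1 b) //= addrK.
    rewrite addmx_sub // -scaleN1r scalemx_sub //; apply: summx_sub => c; exact: sN.
  apply: leq_trans (mxrankS sA) _; apply: leq_trans (mxrank_adds_leqif _ _) _.
  by rewrite leq_add2l.
- have wk : (w * #|nz| <= \sum_a #|supp (row a D)|)%N.
    rewrite mulnC -sum_nat_const; apply: (@leq_trans (\sum_(a in nz) #|supp (row a D)|)).
      apply: leq_sum => a; rewrite inE => nza; apply: wA nza.
      exact: submx_trans (row_sub _ _) sD.
    by rewrite [leqRHS](bigID (mem nz)) /= leq_addr.
  apply: leq_trans (leq_add wk (leqnn _)) _.
  have -> : (\sum_a #|supp (row a D)| = \sum_(j < #|T|) \sum_a (D a j != 0%R : nat))%N.
    rewrite exchange_big; apply: eq_bigr => a _ /=.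
    by rewrite cardsE -sum1_card big_mkcond; apply: eq_bigr => j _; rewrite unfold_in mxE.
  have cE : #|E| = (\sum_(j < #|T|) (enum_val j \in E : nat))%N.
    rewrite -sum1_card big_mkcond /= [RHS](reindex enum_rank) /=; last first.
      by exists enum_val => k _; rewrite ?enum_valK ?enum_rankK.
    by apply: eq_bigr => e _; rewrite enum_rankK.
  have cY : #|col_supp Y| = (\sum_(j < #|T|) (col j Y != 0%R : nat))%N.
    by rewrite cardsE -sum1_card big_mkcond.
  have cR : #|supp R| = (\sum_(j < #|T|) (R 0%R j != 0%R : nat))%N.
    by rewrite cardsE -sum1_card big_mkcond.
  (* The inequality holds column by column. With two indices, at most two stars contain the column
     and [Y] vanishes there; with one index, there is one star and [R] is 1; with none, no star
     contains it. Columns outside [E] are zero. *)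
  rewrite cE cY cR !big_distrr /= -!big_split /=; apply: leq_sum => j _.
  have colY0 : lsubmx (g (enum_val j)) = 0 \/ enum_val j \notin E -> R 0 j = 0 -> col j Y == 0.
    move=> t0 R0; rewrite /Y col_col_mx col_mx_eq0; apply/andP; split; last first.
      by apply/eqP/matrixP => i k; rewrite !ord1 !mxE -[RHS]R0 mxE.
    apply/eqP/matrixP => i k; rewrite !mxE; case: ifP => // jE.
    case: t0 => [/rowP/(_ i)|]; last by rewrite jE.
    by rewrite !mxE.
  have DE a : D a j = if enum_val j \in E then rsubmx (g (enum_val j)) 0 a else 0.
    by rewrite !mxE; case: ifP.
  have [jE|jE] := boolP (enum_val j \in E); last first.
    have D0 a : D a j = 0 by rewrite DE (negbTE jE).
    have R0 : R 0 j = 0 by rewrite RE big1.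
    rewrite big1 => [|a _]; last by rewrite D0 eqxx.
    by rewrite colY0 //; right.
  have [a [b [hE tb]]] := bg _ jE; set h := rsubmx _ in hE.
  have {}DE c : D c j = h 0 c by rewrite DE jE.
  have Rj : R 0 j = a%:R + b%:R.
    rewrite RE (eq_bigr (fun c => eps a 0 c + eps b 0 c)) => [|c _]; last by rewrite DE hE mxE.
    by rewrite big_split /= !sum_eps.
  have -> : (\sum_c (D c j != 0%R : nat) = #|supp h|)%N.
    by rewrite cardsE -sum1_card [RHS]big_mkcond; apply: eq_bigr => c _; rewrite DE.
  have := card_suppD (eps a) (eps b); rewrite -hE !card_supp_eps.
  have : isSome b -> isSome a -> col j Y == 0.
    case: (b) tb Rj => // b' [t0|//]; case: (a) => // a' Rj _ _; apply: colY0; first by left.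
    by rewrite Rj F2_addxx.
  rewrite Rj; case: (col j Y == 0); case: (isSome a); case: (isSome b);
    rewrite ?addr0 ?add0r ?F2_addxx ?oner_eq0 ?eqxx /= => H;
    try (by have := H isT isT); clear H; card_lia.
(* A row basis replaces [Y], so that nonzero coefficients give nonzero vectors; its column support
   lies in that of [Y]. *)
apply: leq_trans (@weight_average _ _ (row_base Y) w _) _.
  move=> v nv; apply: wA.
    apply: submx_trans (submxMl _ _) _; rewrite eq_row_base; exact: sY.
  by apply: contra nv => /eqP v0; apply/eqP/(row_free_inj (row_base_free Y)); rewrite v0 mul0mx.
rewrite leq_mul2l; apply/orP; right; apply/subset_leq_card/subsetP => j; rewrite !inE.
apply: contra => /eqP Yj; have /submxP[X ->] : (row_base Y <= Y)%MS by rewrite eq_row_base.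
by rewrite col_mulmx Yj mulmx0.
Qed.

End RepresentationMatrix.

(** * PG(3,2) minus a line *)

Lemma row2P (F : fieldType) (u v : 'rV[F]_2) :
  u 0 0 = v 0 0 -> u 0 1 = v 0 1 -> u = v.
Proof.
move=> e0 e1; apply/rowP => i.
have [->|->] // : i = 0 \/ i = 1.
by case: i => [[|[|?]]] ? //; [left | right]; apply: val_inj.
Qed.

Section ProjectiveSpace.

Definition point (v : 'rV['F_2]_4) : 'rV['F_2]_4 := v.

Variables x y : 'rV['F_2]_4.
Hypotheses (x0 : x != 0) (y0 : y != 0) (xy : x != y).

Let L : {set 'rV['F_2]_4} := [set x; y; x + y].
Let M := delete PG32 L.
Let E := ground M.

Lemma line_complement v : (v \in E) = (v \notin [:: 0; x; y; x + y]).
Proof. by rewrite /E /= /L !inE !negb_or andbC -!andbA. Qed.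

Lemma card_line_complement : #|E| = 12%N.
Proof.
have -> : E = ~: [set v in [:: 0; x; y; x + y]].
  by apply/setP => v; rewrite line_complement !inE.
have u : uniq [:: 0; x; y; x + y].
  rewrite /= !inE !negb_or ![0 == _]eq_sym x0 y0 xy F2_add_eq0 xy /=.
  by rewrite -subr_eq0 opprD addNKr oppr_eq0 y0 -subr_eq0 opprD addrCA subrr addr0 oppr_eq0 x0.
have := cardsC [set v in [:: 0; x; y; x + y]].
rewrite cardsE (card_uniqP u) card_mx card_Fp //=.
by move: #|_|; clear; lia.
Qed.

(** A nonzero functional is 1 on exactly 8 vectors, the complement of a hyperplane. At most two of
    them lie on [L], since the value at [x + y] is the sum of the values at [x] and [y]. *)
Lemma supp_rep_mx_line (l : 'rV['F_2]_4) : l != 0 ->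
  (6 <= #|supp (l *m rep_mx E point)| <= 8)%N.
Proof.
move=> l0; pose f (v : 'rV['F_2]_4) := (v *m l^T) 0 0.
pose N := [set v | f v != 0].
have cN : #|N| = 8%N.
  have := @card_row_nonorthogonal _ l^T; rewrite trmx_eq0 => /(_ l0).
  by rewrite -/N; lia.
have -> : #|supp (l *m rep_mx E point)| = #|N :&: E|.
  rewrite -[RHS](card_imset _ enum_rank_inj); apply: eq_card => j.
  have vE : (l *m rep_mx E point) 0 j = if enum_val j \in E then f (enum_val j) else 0.
    rewrite /f !mxE; case: ifP => jE; last first.
      by rewrite big1 // => i _; rewrite mxE jE mulr0.
    by apply: eq_bigr => i _; rewrite !mxE jE mulrC.
  rewrite inE vE; apply/idP/imsetP => [|[v]]; last first.
    by rewrite !inE => /andP[fv vE'] ->; rewrite enum_rankK vE'.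
  case: ifP => [jE fj|]; last by rewrite eqxx.
  by exists (enum_val j); rewrite ?enum_valK // in_setI jE inE fj.
have fD v w : f (v + w) = f v + f w by rewrite /f mulmxDl mxE.
have cNL : (#|N :&: L| <= 2)%N.
  have : N :&: L \proper L.
    rewrite properEneq subsetIr andbT; apply/eqP => NL.
    have inN v : v \in L -> f v = 1 by rewrite -NL !inE => /andP[/F2_neq0].
    have := inN (x + y); rewrite fD (inN x) ?(inN y) ?inE ?eqxx ?orbT // => /(_ isT).
    by move/eqP.
  move/proper_card => lt; rewrite -ltnS; apply: leq_trans lt _.
  rewrite /L setUC cardsU1 cards2; by case: (_ \notin _); case: (_ != _).
have : (#|N| <= #|N :&: E| + #|N :&: L|)%N.
  rewrite -cardsUI -setIUr; apply: leq_trans (leq_addr _ _).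
  apply/subset_leq_card/subsetP => v; rewrite in_setI in_setU line_complement => vN.
  rewrite vN /L !inE !negb_or /=; move: vN; rewrite inE; case: (eqVneq v 0) => [->|_ _].
    by rewrite /f mul0mx mxE eqxx.
  by case: (v == x); case: (v == y); case: (v == x + y).
have := subset_leq_card (subsetIl N E); rewrite cN.
by move: #|_| #|_| cNL => a b; clear; lia.
Qed.

Lemma PG32_line_not_block : ~ block_represented M.
Proof.
case=> n [g [bg rep]].
have repM : represented M (zero_sum point) by apply: represented_delete; apply: represented_vector.
have eqZ := represented_uniq (zero_sum_space g) (zero_sum_space point) rep repM.
have s1 : (rep_mx E g <= rep_mx E point)%MS.
  by apply: rep_mx_sub => X sX; rewrite eqZ.
have s2 : (rep_mx E point <= rep_mx E g)%MS.
  by apply: rep_mx_sub => X sX; rewrite eqZ.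
have wt v : (v <= rep_mx E g)%MS -> v != 0 -> (6 <= #|supp v| <= 8)%N.
  move=> /submx_trans/(_ s1)/submxP[l ->] nv; apply: supp_rep_mx_line.
  by apply: contra nv => /eqP->; rewrite mul0mx.
have rk : (4 <= \rank (rep_mx E g))%N.
  apply: leq_trans (mxrankS s2); suff /eqP-> : row_free (rep_mx E point) by [].
  apply: inj_row_free => l lA; apply/eqP; apply: contraT => /supp_rep_mx_line.
  rewrite lA (_ : supp 0 = set0) ?cards0 //.
  by apply/setP => j; rewrite !inE mxE eqxx.
have wt6 v : (v <= rep_mx E g)%MS -> v != 0 -> (6 <= #|supp v|)%N.
  by move=> sv nv; have /andP[] := wt v sv nv.
have [P [R [k /= [sY rkY cnt avg]]]] := block_vector_count bg wt6.
have wR : (#|supp R| <= 8)%N.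
  have [->|nR] := eqVneq R 0.
    by rewrite (_ : supp 0 = set0) ?cards0 //; apply/setP => j; rewrite !inE mxE eqxx.
  have /(wt R) : (R <= rep_mx E g)%MS by apply: submx_trans sY; rewrite -addsmxE addsmxSr.
  by move=> /(_ nR)/andP[].
have uR : (#|supp R| <= #|col_supp (col_mx P R)|)%N.
  apply/subset_leq_card/subsetP => j; rewrite !inE; apply: contra => /eqP.
  rewrite col_col_mx => /eqP; rewrite col_mx_eq0 => /andP[_ /eqP/matrixP/(_ 0 0)].
  by rewrite !mxE => ->.
have d3 : (\rank (col_mx P R) <= 3)%N := rank_leq_row _.
move: cnt; rewrite -/E card_line_complement; move: d3 uR wR avg rkY rk.
move: (\rank _) (\rank _) #|supp R| #|col_supp _| => r d w u.
(* For [d = 3, 2, 1] the bounds give [k >= 2, 3, 4] and [s >= 11, 9, 6], so [6 k + 2 s] is at least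
   34, above the allowed 8 + 24. For [d = 0], [k >= 5] and [|R| <= s] give [30 + s <= 24]. *)
by clear; case: d => [|[|[|[|d]]]] //; rewrite ?expnS ?expn0; lia.
Qed.

(** Take coordinates in the basis [x + e], [y + e], [z], [z + (x + y + e)], the first two spanning
    the [F_2^2] part. The vectors with both of the last coordinates equal to 1 are [x + y + e], [x],
    [y] and [e]; only the first survives, and its [F_2^2] part is zero. *)
Lemma PG32_line_delete e : e \in E -> exists n (g : 'rV['F_2]_4 -> 'rV['F_2]_(2 + n)),
  (forall v, v \in E :\ e -> block_vector (g v)) /\
  (forall X : {set 'rV['F_2]_4}, X \subset E :\ e -> zero_sum g X = zero_sum point X).
Proof.
rewrite line_complement !inE !negb_or => /and4P[e0 ex ey exy].
pose comb (p : 'F_2 * 'F_2 * 'F_2) := p.1.1 *: x + p.1.2 *: y + p.2 *: e.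
(* The span of [x], [y], [e] has at most 8 of the 16 vectors. *)
have [z zS] : exists z, z \notin [set comb p | p in [set: 'F_2 * 'F_2 * 'F_2]].
  apply/existsP; rewrite -negb_forall; apply/negP => /forallP H.
  have := leq_imset_card comb [set: 'F_2 * 'F_2 * 'F_2].
  rewrite (_ : _ @: _ = setT); last by apply/setP => v; rewrite inE (H v).
  by rewrite !cardsT card_mx !card_prod card_Fp.
have indep_xyez a b c d : a *: x + b *: y + c *: e + d *: z = 0 ->
    [/\ a = 0, b = 0, c = 0 & d = 0].
  have [->|->] := F2_cases d; last first.
    move=> /eqP; rewrite scale1r F2_add_eq0 => /eqP H; case/negP: zS.
    by apply/imsetP; exists (a, b, c).
  rewrite scale0r addr0; have [->|->] := F2_cases c; last first.
    move=> /eqP; rewrite scale1r F2_add_eq0 => /eqP H; move: e0 ex ey exy; rewrite -H.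
    have [->|->] := F2_cases a; have [->|->] := F2_cases b;
      by rewrite ?scale0r ?scale1r ?addr0 ?add0r ?eqxx.
  rewrite scale0r addr0; have [->|->] := F2_cases b; last first.
    move=> /eqP; rewrite scale1r F2_add_eq0 => /eqP H; move: y0 xy; rewrite -H.
    by have [->|->] := F2_cases a; rewrite ?scale0r ?scale1r ?eqxx.
  rewrite scale0r addr0; have [->|->] := F2_cases a => //.
  by rewrite scale1r => /eqP; rewrite (negbTE x0).
pose N : 'M['F_2]_(2 + 2, 4) :=
  \matrix_k nth 0 [:: x + e; y + e; z; z + (x + y + e)] k.
have NE (w : 'rV['F_2]_(2 + 2)) : w *m N =
    w 0 (lshift 2 0) *: (x + e) + w 0 (lshift 2 1) *: (y + e) +
    w 0 (rshift 2 0) *: z + w 0 (rshift 2 1) *: (z + (x + y + e)).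
  rewrite mulmx_sum_row big_split_ord !big_ord_recl !big_ord0 /= !rowK /= !addr0 !addrA.
  by do !f_equal; apply: val_inj.
have freeN : row_free N.
  apply: inj_row_free => w; rewrite NE => wN.
  set a := w 0 (lshift 2 0) in wN; set b := w 0 (lshift 2 1) in wN.
  set c := w 0 (rshift 2 0) in wN; set d := w 0 (rshift 2 1) in wN.
  have [|ad bd abd cd] := indep_xyez (a + d) (b + d) (a + b + d) (c + d).
    by rewrite -[RHS]wN; apply/rowP => i; rewrite !mxE; ring.
  have [a0 b0 c0 d0] : [/\ a = 0, b = 0, c = 0 & d = 0].
    move: ad bd abd cd.
    by have [->|->] := F2_cases a; have [->|->] := F2_cases b;
      have [->|->] := F2_cases c; have [->|->] := F2_cases d => // /eqP.
  have wl : lsubmx w = 0 by apply: row2P; rewrite [LHS]mxE [RHS]mxE.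
  have wr : rsubmx w = 0 by apply: row2P; rewrite [LHS]mxE [RHS]mxE.
  by rewrite -(hsubmxK w) wl wr row_mx0.
have uN : N \in unitmx by rewrite -row_free_unit.
exists 2, (fun v => v *m invmx N); split=> [v|X _].
  rewrite in_setD1 line_complement !inE !negb_or => /and5P[ve _ vx vy vxy].
  set w := v *m invmx N; have vE : v = w *m N by rewrite mulmxKV.
  have l2 i : lsubmx w 0 i = w 0 (lshift 2 i) by rewrite mxE.
  have r2 i : rsubmx w 0 i = w 0 (rshift 2 i) by rewrite mxE.
  rewrite NE in vE; have [h0|h0] := F2_cases (w 0 (rshift 2 0));
    have [h1|h1] := F2_cases (w 0 (rshift 2 1)).
  - by exists None, None; split; [apply: row2P; rewrite r2 ?h0 ?h1 !mxE addr0 | right].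
  - by exists (Some 1), None; split; [apply: row2P; rewrite r2 ?h0 ?h1 !mxE addr0 | right].
  - by exists (Some 0), None; split; [apply: row2P; rewrite r2 ?h0 ?h1 !mxE addr0 | right].
  - exists (Some 0), (Some 1); split.
      by apply: row2P; rewrite r2 ?h0 ?h1 !mxE ?addr0 ?add0r.
    left; rewrite h0 h1 !scale1r -addrA [z + (z + _)]addrA F2_add_self add0r in vE.
    have dbl (a b : 'rV['F_2]_4) : a + (a + b) = b by rewrite addrA F2_add_self add0r.
    move: ve vx vy vE; rewrite -[x + y + e]addrA.
    have [t0|t0] := F2_cases (w 0 (lshift 2 0)); have [t1|t1] := F2_cases (w 0 (lshift 2 1));
      rewrite t0 t1 ?scale0r ?scale1r ?addr0 ?add0r.
    + by move=> *; apply: row2P; rewrite l2 ?t0 ?t1 mxE.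
    + by move=> _ vx _ vE; case/eqP: vx; rewrite vE [LHS]addrCA F2_add_self addr0.
    + move=> _ _ vy vE; case/eqP: vy.
      by rewrite vE [LHS]addrACA F2_add_self add0r [LHS]addrCA F2_add_self addr0.
    + move=> ve _ _ vE; case/eqP: ve.
      by rewrite vE [x + e + _]addrACA F2_add_self addr0 [LHS]addrACA F2_add_self add0r dbl.
rewrite /zero_sum -mulmx_suml; apply/eqP/eqP => [H|->]; last by rewrite mul0mx.
by rewrite -[LHS](mulmxKV uN) H mul0mx.
Qed.

(** Contracting [e] leaves vectors in dimension 3, and for [n = 1] every vector of [F_2^(2 + 1)] has
    block shape. The map clears a coordinate [k] with [e_k = 1] and then drops it. *)
Lemma PG32_line_contract e : e \in E -> exists n (g : 'rV['F_2]_4 -> 'rV['F_2]_(2 + n)),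
  (forall v, v \in E :\ e -> block_vector (g v)) /\
  (forall X : {set 'rV['F_2]_4}, X \subset E :\ e -> zero_sum g X = zero_sum point X || zero_sum point (e |: X)).
Proof.
rewrite line_complement !inE !negb_or => /andP[/rV0Pn[k /F2_neq0 ek] _].
exists 1, (fun v : 'rV['F_2]_4 => col' k (v + v 0 k *: e)); split=> [v _|X sX].
  set w := col' k _ : 'rV['F_2]_(2 + 1).
  exists (if rsubmx w 0 0 == 0 then None else Some 0), None; split; last by right.
  rewrite addr0; apply/rowP => i; rewrite !ord1; case: ifP => [/eqP->|/negbT/F2_neq0->]; by rewrite mxE.
have eX : e \notin X by apply/negP => /(subsetP sX); rewrite !inE eqxx.
rewrite zero_sum_setU1 // /zero_sum; set s := \sum_(v in X) point v.
have -> : \sum_(v in X) col' k (v + v 0 k *: e) = col' k (s + s 0 k *: e).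
  rewrite -linear_sum /= big_split /= -scaler_suml -summxE //.
have -> : (col' k (s + s 0 k *: e) == 0) = (s + s 0 k *: e == 0).
  apply/eqP/eqP => [H|->]; last by rewrite linear0.
  apply/rowP => i; have [j ->|->] := unliftP k i.
    by move/rowP/(_ j): H; rewrite mxE [RHS]mxE => ->; rewrite mxE.
  by rewrite mxE [X in _ + X]mxE ek mulr1 [RHS]mxE F2_addxx.
have [s0|s1] := F2_cases (s 0 k).
  rewrite s0 scale0r addr0; case: (eqVneq s e) => [se|_]; last by rewrite orbF.
  by rewrite se ek in s0; move/eqP: s0; rewrite oner_eq0.
rewrite s1 scale1r F2_add_eq0; case: (eqVneq s 0) => //= s0.
by rewrite s0 mxE in s1; move/eqP: s1; rewrite eq_sym oner_eq0.
Qed.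

End ProjectiveSpace.

(** * Duality *)

Section Duality.

Variables (T : finType) (p : nat) (f : T -> 'cV['F_2]_p).

Definition cocycle (E : {set T}) (l : 'rV['F_2]_p) : {set T} :=
  [set e in E | (l *m f e) 0 0 != 0].

Definition cocycles (E : {set T}) : pred {set T} :=
  fun S => [exists l : 'rV['F_2]_p, S == cocycle E l].

Lemma cocycles_space E : cycle_space (cocycles E).
Proof.
split=> [|A B /existsP[a /eqP->] /existsP[b /eqP->]]; apply/existsP.
  by exists 0; apply/eqP/setP => e; rewrite !inE mul0mx mxE eqxx andbF.
exists (a + b); apply/eqP/setP => e; rewrite !inE mulmxDl [(_ + _ : 'M_1) 0 0]mxE; case: (e \in E) => //=.
have [->|->] := F2_cases ((a *m f e) 0 0); have [->|->] := F2_cases ((b *m f e) 0 0);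
  by rewrite ?addr0 ?add0r ?F2_addxx ?oner_eq0 ?eqxx.
Qed.

Variable M : matroid T.
Hypothesis rep : represented M (zero_sum f).

Lemma dependent_orthogonal (B : {set T}) e (l : 'rV['F_2]_p) :
  indep M B -> e \in ground M -> ~~ indep M (e |: B) ->
  (forall b, b \in B -> (l *m f b) 0 0 = 0) -> (l *m f e) 0 0 = 0.
Proof.
move=> iB eM dep lB.
have sB : e |: B \subset ground M by rewrite subUset sub1set eM indep_ground.
have [X [sX zX nX]] := represented_dep rep sB dep.
have eX : e \in X.
  apply: contraT => eX; case/negP: nX; apply/eqP; have /rep[_] := iB; apply=> //.
  apply/subsetP => x xX; have := subsetP sX x xX; rewrite !inE => /orP[/eqP xe|//].
  by rewrite -xe xX in eX.
have : (l *m \sum_(x in X) f x) 0 0 = 0 by rewrite (eqP zX) mulmx0 mxE.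
rewrite mulmx_sumr summxE (big_setD1 e) //= big1 ?addr0 // => x.
rewrite !inE => /andP[xe /(subsetP sX)]; rewrite !inE (negbTE xe) /=; exact: lB.
Qed.

(** If every functional vanishing on [B] vanished at [e], the cokernel criterion would put [f e] in
    the span of the vectors of [B], and the coefficients would give a zero-sum set through [e]
    inside [e |: B]. *)
Lemma separating_functional (B : {set T}) e : e \notin B -> indep M (e |: B) ->
  exists2 l : 'rV['F_2]_p, (l *m f e) 0 0 = 1 & forall b, b \in B -> (l *m f b) 0 0 = 0.
Proof.
move=> eB ieB.
have [/existsP[l /andP[/F2_neq0 le /forallP lB]]|no] :=
  boolP [exists l : 'rV['F_2]_p, ((l *m f e) 0 0 != 0) && [forall b in B, (l *m f b) 0 0 == 0]].
  by exists l => // b bB; apply/eqP; have := lB b; rewrite bB.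
pose F : 'M['F_2]_(#|B|, p) := \matrix_i (f (enum_val i))^T.
have : ((f e)^T <= F)%MS.
  rewrite submxE; apply/eqP/matrixP => i j; rewrite ord1 [RHS]mxE.
  set l := (col j (cokermx F))^T.
  have -> : ((f e)^T *m cokermx F) 0 j = (l *m f e) 0 0.
    by rewrite [LHS]mxE [RHS]mxE; apply: eq_bigr => k _; rewrite /l !mxE mulrC.
  apply/eqP; apply: contraNT no => le; apply/existsP; exists l; rewrite le /=.
  apply/forallP => b; apply/implyP => bB.
  have -> : (l *m f b) 0 0 = (F *m cokermx F) (enum_rank_in bB b) j.
    rewrite [LHS]mxE [RHS]mxE; apply: eq_bigr => k _.
    by rewrite [l _ _]mxE [col _ _ _ _]mxE [F _ _]mxE [_^T _ _]mxE enum_rankK_in // mulrC.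
  by rewrite mulmx_coker mxE.
case/submxP => l fe; case/negP: no.
have /rep[_ /(_ (e |: [set enum_val i | i in [set i | l 0 i != 0]]))] := ieB.
rewrite setUS; last by apply/subsetP => _ /imsetP[i _ ->]; apply: enum_valP.
move=> /(_ isT); rewrite zero_sum_setU1; last first.
  by apply: contra eB => /imsetP[i _ ->]; apply: enum_valP.
rewrite big_imset /=; last by move=> i j _ _; apply: enum_val_inj.
have -> : \sum_(i in [set i | l 0 i != 0]) f (enum_val i) = f e.
  apply: trmx_inj; rewrite fe mulmx_sum_row [LHS]linear_sum [LHS]big_mkcond /=.
  apply: eq_bigr => i _; rewrite inE rowK.
  by have [->|->] := F2_cases (l 0 i); rewrite ?eqxx ?oner_eq0 ?scale0r ?scale1r.
by rewrite eqxx => /(_ isT)/setP/(_ e); rewrite setU11 inE.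
Qed.

(** Forward, a cocycle inside [I] vanishes on a basis disjoint from [I], hence everywhere. Backward,
    let [B] be maximal independent outside [I]. If some [e] extended [B], a functional that is 1 at
    [e] and 0 on [B] would vanish on all elements outside [I], so its nonempty cocycle would lie
    inside [I]. *)
Lemma represented_dual : represented (dual M) (cocycles (ground M)).
Proof.
move=> I; split.
  case/andP=> sI /existsP[B /andP[bB dIB]]; split=> // S sS /existsP[l /eqP SE].
  have [iB maxB] := basisP _ _ bB.
  apply/eqP; rewrite -subset0; apply/subsetP => e eS.
  have eB : e \notin B by rewrite (disjointFr dIB (subsetP sS e eS)).
  have := eS; rewrite SE !inE => /andP[eM /eqP[]].
  apply: (dependent_orthogonal iB eM).
    by apply/negP => /maxB; rewrite cardsU1 eB add1n ltnn.
  move=> b bB'; have bS : b \notin S.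
    by apply/negP => /(subsetP sS) bI; rewrite (disjointFr dIB bI) in bB'.
  apply/eqP; apply: contraNT bS => lb; rewrite SE inE lb andbT.
  exact: subsetP (basis_sub_ground bB) b bB'.
case=> sI noZ; apply/andP; split=> //.
have [|B /maxsetP[/andP[iB sB] maxB] _] :=
  @maxset_exists _ (fun J => indep M J && (J \subset ~: I)) set0.
  by rewrite indep0 sub0set.
apply/existsP; exists B; rewrite disjoint_sym disjoints_subset sB andbT.
apply/basisP; split=> // J iJ; rewrite leqNgt; apply/negP => /(indep_aug iB iJ)[e].
rewrite inE => /andP[eB eJ] ieB.
have [l le lB] := separating_functional eB ieB.
have eM : e \in ground M := subsetP (indep_ground iJ) e eJ.
have : cocycle (ground M) l = set0.
  apply: noZ; last by apply/existsP; exists l.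
  apply/subsetP => h; rewrite inE => /andP[hM lh]; apply: contraT => hI.
  case/eqP: lh; have [ih|] := boolP (indep M (h |: B)); last first.
    by move=> dh; apply: (dependent_orthogonal iB hM dh lB).
  have := maxB (h |: B); rewrite ih subUset sub1set inE hI sB subsetUr => /(_ isT isT) hB.
  by apply: lB; rewrite -hB setU11.
by move/setP/(_ e); rewrite !inE eM le oner_eq0.
Qed.

End Duality.

(** * The dual of K_6 *)

Lemma represented_cycle_matroid (G : graph) :
  represented (cycle_matroid G) (zero_sum (@inc_col G)).
Proof.
move=> I; rewrite /= acyclicE; split=> [/F2_free H|[_ H]].
  by rewrite subsetT; split=> // S sS /eqP; apply: H.
by apply/F2_free => S sS /eqP; apply: H.
Qed.

Section DualK6.

Let G := complete_graph 6.
Let M := dual (cycle_matroid G).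
Implicit Types (e : complete_edge 6) (S : {set complete_edge 6}).

Definition cuts : pred {set complete_edge 6} := cocycles (@inc_col G) [set: complete_edge 6].

Lemma cuts_space : cycle_space cuts.
Proof. exact: cocycles_space. Qed.

Lemma represented_dual_K6 : represented M cuts.
Proof. exact: (represented_dual (@represented_cycle_matroid G)). Qed.

Lemma cutsP S :
  reflect (exists h : 'I_6 -> 'F_2, forall e a b, val e = [set a; b] -> (e \in S) = (h a != h b))
          (cuts S).
Proof.
have lE (l : 'rV['F_2]_#|vertex G|) (e : edge G) (a b : 'I_6) : val e = [set a; b] ->
    (l *m inc_col e) 0 0 = l 0 (enum_rank (a : vertex G)) + l 0 (enum_rank (b : vertex G)).
  by move=> /(@inc_colE G) ->; rewrite mulmxDr -!colE !mxE.
have neqE (c d : 'F_2) : (c + d != 0) = (c != d).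
  by have [->|->] := F2_cases c; have [->|->] := F2_cases d.
apply: (iffP existsP) => [[l /eqP->]|[h hS]].
  by exists (fun a => l 0 (enum_rank (a : vertex G))) => e a b /lE le; rewrite !inE le neqE.
exists (\row_j h (enum_val j)); apply/eqP/setP => e.
have [a [b eab]] := @ends_pair G e.
by rewrite (hS e a b eab) !inE (lE _ _ _ _ eab) !mxE !enum_rankK neqE.
Qed.

Lemma edge_ex (a b : 'I_6) : a != b -> exists e : complete_edge 6, val e = [set a; b].
Proof.
by move=> ab; have c2 : #|[set a; b]| == 2; [rewrite cards2 ab | exists (exist _ [set a; b] c2)].
Qed.

Lemma edge_ends e : exists a b, a != b /\ val e = [set a; b].
Proof. by have /cards2P[a [b [ab ->]]] := valP e; exists a, b. Qed.

Lemma edge_mem e a b : a != b -> a \in val e -> b \in val e -> val e = [set a; b].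
Proof.
move=> ab ae be; apply/esym/eqP.
by rewrite eqEcard subUset !sub1set ae be cards2 ab (eqP (valP e)).
Qed.

Lemma star_cut (a : 'I_6) : cuts [set e : complete_edge 6 | a \in val e].
Proof.
apply/cutsP; exists (fun b => (b == a)%:R) => e b c ebc.
have : b != c by have := valP e; rewrite ebc cards2; case: (b != c).
rewrite inE ebc !inE ![a == _]eq_sym => bc.
case: (eqVneq b a) bc => [->|_ _]; first by rewrite eq_sym => /negbTE->.
by case: (c == a).
Qed.

Lemma card_K6 : #|{: complete_edge 6}| = 15%N.
Proof.
rewrite card_sig; transitivity 'C(#|'I_6|, 2); last by rewrite card_ord.
by rewrite -card_draws cardsE; apply: eq_card.
Qed.

(** These edges contain no nonempty cut, so they are independent in the dual and give the lower
    bound 10 on the rank. *)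
Lemma card_K6_minus_vertex : #|[set e : complete_edge 6 | ord0 \notin val e]| = 10%N.
Proof.
transitivity 'C(#|[set~ (ord0 : 'I_6)]|, 2); last by rewrite cardsC1 card_ord.
rewrite -cards_draws -(card_imset _ val_inj); apply: eq_card => A; rewrite !inE.
rewrite -disjoints_subset disjoint_sym disjoints1; apply/imsetP/andP => [[e]|[A0 A2]].
  by rewrite inE => e0 ->; split=> //; apply: (valP e).
by exists (exist _ A A2); rewrite ?inE.
Qed.

Lemma dual_K6_not_block : ~ block_represented M.
Proof.
case=> n [g [bg rep]].
have eqZ := represented_uniq (zero_sum_space g) cuts_space rep represented_dual_K6.
pose E := [set: complete_edge 6].
have wt v : (v <= rep_mx E g)%MS -> v != 0 -> (3 <= #|supp v|)%N.
  move=> sv /rV0Pn[j vj]; pose N := [set e : complete_edge 6 | v 0 (enum_rank e) != 0].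
  have -> : #|supp v| = #|N|.
    rewrite -[RHS](card_imset _ enum_rank_inj); apply: eq_card => k; rewrite inE.
    apply/idP/imsetP => [vk|[e]]; last by rewrite inE => ve ->.
    by exists (enum_val k); rewrite ?enum_valK // inE enum_valK.
  (* [v] is orthogonal to the cut at [a], so [N] has even degree at [a]. As [K_6] is simple, the
     further edges at the two ends of an edge of [N] are distinct, which gives weight at least 3. *)
  have other e a : e \in N -> a \in val e -> exists e', [/\ e' \in N, e' != e & a \in val e'].
    rewrite inE => eN ae.
    have [/existsP[e' /and3P[? ? ?]]|] :=
      boolP [exists e', [&& e' \in N, e' != e & a \in val e']]; first by exists e'.
    rewrite negb_exists => /forallP no.
    have := rep_mx_orthogonal (subsetT _) _ sv (X := [set e : complete_edge 6 | a \in val e]).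
    rewrite eqZ ?subsetT // star_cut => /(_ isT); rewrite (big_setD1 e) ?inE //=.
    rewrite big1 ?addr0 => [/eqP|e']; first by rewrite (negbTE eN).
    rewrite !inE => /andP[ne ae']; apply/eqP; have := no e'.
    by rewrite ne ae' !andbT inE negbK.
  pose e := enum_val j; have eN : e \in N by rewrite inE enum_valK.
  have [a [b [ab eab]]] := edge_ends e.
  have [|e1 [e1N e1e ae1]] := other e a eN; first by rewrite eab !inE eqxx.
  have [|e2 [e2N e2e be2]] := other e b eN; first by rewrite eab !inE eqxx orbT.
  have e12 : e1 != e2.
    apply: contraNneq e1e => e12; apply/eqP/val_inj; rewrite eab.
    by apply: edge_mem; rewrite // e12.
  apply: (@leq_trans #|[set e; e1; e2]|); last first.
    by apply/subset_leq_card/subsetP => x; rewrite in_setU in_set2 in_set1 => /orP[/orP[]|] /eqP->.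
  rewrite setUC cardsU1 cards2 !inE negb_or e2e [e == e1]eq_sym e1e [e2 == e1]eq_sym e12 //.
have rk : (10 <= \rank (rep_mx E g))%N.
  apply: (@leq_trans #|[set e : complete_edge 6 | ord0 \notin val e]|).
    by rewrite card_K6_minus_vertex.
  apply: rep_mx_rank; first exact: subsetT.
  move=> S sS; rewrite eqZ ?subsetT // => /cutsP[h hS].
  apply/eqP; rewrite -subset0; apply/subsetP => e eS.
  have [a [b [ab eab]]] := edge_ends e.
  have := subsetP sS e eS; rewrite inE eab !inE negb_or => /andP[a0 b0].
  have h0 c : ord0 != c -> h ord0 = h c.
    move=> c0; have [e' e'E] := edge_ex c0; have := hS _ _ _ e'E.
    case: (boolP (e' \in S)) => [/(subsetP sS)|_ /esym/negbFE/eqP //].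
    by rewrite inE e'E !inE eqxx.
  by have := hS _ _ _ eab; rewrite eS -(h0 a) // -(h0 b) // eqxx.
have bgE e : e \in E -> block_vector (g e) by apply: bg.
have [P [R [k /= [sY rkY cnt avg]]]] := block_vector_count bgE wt.
set Y := col_mx P R in sY rkY cnt avg.
have sRY : supp R \subset col_supp Y.
  apply/subsetP => j; rewrite !inE; apply: contra => /eqP.
  rewrite col_col_mx => /eqP; rewrite col_mx_eq0 => /andP[_ /eqP/matrixP/(_ 0 0)].
  by rewrite !mxE => ->.
have d3 : (\rank Y <= 3)%N := rank_leq_row _.
(* With [|R| <= s] the count gives [3 k + s <= 30]. For [d = 0, 1, 2] the rank forces
   [k >= 11, 10, 9] and the average [s >= 0, 3, 5], which is too much; for [d = 3], [k >= 8] and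
   [s >= 6] leave equality only. *)
have [dY uY wR] : [/\ \rank Y = 3, #|col_supp Y| = 6 & #|supp R| = 6]%N.
  have uR := subset_leq_card sRY.
  have cE : #|E| = 15%N by rewrite cardsT card_K6.
  move: cnt; rewrite cE; move: d3 uR avg rkY rk.
  move: (\rank _) (\rank _) #|supp R| #|col_supp _| => r d w u.
  clear; case: d => [|[|[|[|d]]]] //; rewrite ?expnS ?expn0 => *; try (exfalso; lia).
  by split; lia.
have freeY : row_free Y by rewrite /row_free dY.
(* The support of [l *m P] lies in that of [R], so the weights of [l *m P] and [l *m P + R] add up
   to 6, and both are at least 3 because the rows of [Y] are independent. *)
have supp3 (l : 'rV['F_2]_2) : l != 0 -> #|supp (l *m P)| = 3%N.
  move=> l0.
  have sub : supp (l *m P) \subset supp R.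
    have -> : supp R = col_supp Y by apply/eqP; rewrite eqEcard sRY uY wR.
    apply/subsetP => j; rewrite !inE; apply: contra => /eqP.
    rewrite col_col_mx => /eqP; rewrite col_mx_eq0 => /andP[/eqP Pj _].
    have -> : (l *m P) 0 j = (l *m col j P) 0 0 by rewrite -col_mulmx [RHS]mxE.
    by rewrite Pj mulmx0 mxE.
  have ge3 (t : 'rV['F_2]_1) : (3 <= #|supp (l *m P + t *m R)|)%N.
    rewrite -mul_row_col; apply: wt; first exact: submx_trans (submxMl _ _) sY.
    apply: contra l0 => /eqP H; have : row_mx l t = 0.
      by apply: (row_free_inj freeY); rewrite H mul0mx.
    by move/eqP; rewrite row_mx_eq0 => /andP[].
  have a3 : (3 <= #|supp (l *m P)|)%N by have := ge3 0; rewrite mul0mx addr0.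
  have b3 : (3 <= #|supp (l *m P + R)|)%N by have := ge3 1%:M; rewrite mul1mx.
  have := card_suppD (l *m P) R; rewrite (setIidPl sub) wR.
  by move: a3 b3; move: #|supp (l *m P + R)| #|supp (l *m P)| => a b; clear; lia.
(* Two rows of weight 3 have a sum of even weight, which cannot be 3. *)
have := card_suppD (delta_mx 0 0 *m P) (delta_mx 0 1 *m P).
rewrite -mulmxDl (supp3 (delta_mx 0 0)); last by apply/rV0Pn; exists 0; rewrite mxE.
rewrite (supp3 (delta_mx 0 1)); last by apply/rV0Pn; exists 1; rewrite mxE.
rewrite supp3; last by apply/rV0Pn; exists 0; rewrite !mxE.
card_lia.
Qed.

End DualK6.

(** * Explicit matrices for the single-element minors of the dual of [K_6] *)

Fixpoint forall_bits n : (seq bool -> bool) -> bool :=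
  if n is n'.+1 then
    fun P => forall_bits n' (fun l => P (true :: l)) && forall_bits n' (fun l => P (false :: l))
  else fun P => P [::].

Lemma forall_bitsP n P l : forall_bits n P -> size l = n -> P l.
Proof.
elim: n P l => [|n IH] P [|b l] //= /andP[Ht Hf] [sl].
by case: b; [apply: (IH (fun l => P (true :: l))) | apply: (IH (fun l => P (false :: l)))].
Qed.

Definition K6_pairs : seq (nat * nat) :=
  [:: (0, 1); (0, 2); (0, 3); (0, 4); (0, 5); (1, 2); (1, 3); (1, 4); (1, 5);
      (2, 3); (2, 4); (2, 5); (3, 4); (3, 5); (4, 5)]%N.

Definition row_parity (s : nat * nat -> bool) (r : seq (nat * nat)) :=
  foldr (fun p b => s p (+) b) false r.

Definition rows_even s (rows : seq (seq (nat * nat))) := all (fun r => ~~ row_parity s r) rows.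

(* A cut is determined by the edges at vertex [0]. *)
Definition cut_at (s : nat * nat -> bool) (p : nat * nat) :=
  let t i := if i is 0%N then false else s (0%N, i) in s p == t p.1 (+) t p.2.

Definition triangle (i j k : nat) := [:: (i, j); (i, k); (j, k)].

(* In both lists the first two rows are the coordinates in [F_2^2] and the other
   rows are the vertex stars; [(4, 5)] is the edge of [K_6] being removed. *)
Definition delete_rows :=
  [:: triangle 0 1 2; triangle 1 2 3;
      [:: (0, 4); (0, 5)]; [:: (1, 4); (1, 5)]; [:: (2, 4); (2, 5)]; [:: (3, 4); (3, 5)];
      [:: (0, 4); (0, 1); (1, 5)]; [:: (1, 4); (1, 2); (2, 5)];
      [:: (2, 4); (2, 3); (3, 5)]; [:: (3, 4); (0, 3); (0, 5)]]%N.

Definition contract_rows :=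
  [:: triangle 1 2 3; triangle 1 2 4;
      triangle 0 1 2; triangle 0 1 4; triangle 0 2 5; triangle 0 3 4; triangle 0 3 5;
      triangle 1 3 5; triangle 2 3 4]%N.

(** The bits follow the order of [rem (4, 5) K6_pairs], so a set of pairs without [(4, 5)] is
    recovered from its list of values by computation. *)
Definition pair_table (l : seq bool) (p : nat * nat) : bool :=
  if l is [:: b01; b02; b03; b04; b05; b12; b13; b14; b15;
              b23; b24; b25; b34; b35]
  then match p with
    | (0, 1) => b01 | (0, 2) => b02 | (0, 3) => b03 | (0, 4) => b04 | (0, 5) => b05
    | (1, 2) => b12 | (1, 3) => b13 | (1, 4) => b14 | (1, 5) => b15 | (2, 3) => b23
    | (2, 4) => b24 | (2, 5) => b25 | (3, 4) => b34 | (3, 5) => b35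
    | _ => false
  end%N else false.

Lemma all_K6_pairs (P : pred (nat * nat)) :
  all P K6_pairs = all P (rem (4, 5)%N K6_pairs) && P (4, 5)%N.
Proof. by rewrite /= !andbT -!andbA. Qed.

(** The rows are cycles of [K_6] with 4 and 5 identified, and the sets even on all of them are the
    cuts of [K_6] avoiding [(4, 5)]. This is checked on all [2^14] sets; the condition at [(4, 5)]
    becomes [s (0, 4) = s (0, 5)]. *)
Lemma delete_rows_cut s : ~~ s (4, 5)%N ->
  rows_even s delete_rows = all (cut_at s) K6_pairs.
Proof.
move=> s45; pose P l := let s := pair_table l in
  rows_even s delete_rows == all (cut_at s) (rem (4, 5)%N K6_pairs) && ~~ (s (0, 4) (+) s (0, 5))%N.
have H : forall_bits 14 P by vm_compute.
have /eqP-> : rows_even s delete_rows ==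
    all (cut_at s) (rem (4, 5)%N K6_pairs) && ~~ (s (0, 4) (+) s (0, 5))%N.
  exact: (@forall_bitsP 14 P [seq s p | p <- rem (4, 5)%N K6_pairs] H (erefl _)).
rewrite all_K6_pairs; congr (_ && _); rewrite /cut_at /= (negbTE s45).
by case: (_ (+) _).
Qed.

(** The rows are triangles of [K_6] without the edge [(4, 5)]; evenness on them characterizes the
    cuts of that graph, again by enumeration. *)
Lemma contract_rows_cut s :
  rows_even s contract_rows = all (cut_at s) (rem (4, 5)%N K6_pairs).
Proof.
pose P l := let s := pair_table l in
  rows_even s contract_rows == all (cut_at s) (rem (4, 5)%N K6_pairs).
have H : forall_bits 14 P by vm_compute.
apply/eqP; exact: (@forall_bitsP 14 P [seq s p | p <- rem (4, 5)%N K6_pairs] H (erefl _)).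
Qed.

(** A decidable form of [block_vector] for the column of [p]; the shift by 2 skips the two rows of
    the [F_2^2] part. *)
Definition block_pair n (rows : seq (seq (nat * nat))) p :=
  let c := count (fun a => p \in nth [::] rows a.+2) (iota 0 n) in
  (c <= 1)%N || [&& c == 2, p \notin nth [::] rows 0 & p \notin nth [::] rows 1].

Lemma block_vector_card n (x : 'rV['F_2]_(2 + n)) :
  (#|supp (rsubmx x)| <= 1)%N || (#|supp (rsubmx x)| == 2) && (lsubmx x == 0) ->
  block_vector x.
Proof.
have rowE a b (S := [set i | (a == Some i) != (b == Some i)]) :
    supp (rsubmx x) = S -> rsubmx x = eps a + eps b.
  move=> sx; apply/rowP => i; rewrite [RHS]mxE !eps_coord.
  have := in_set (fun i => rsubmx x 0 i != 0) i; rewrite -/(supp _) sx inE.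
  have [->|->] := F2_cases (rsubmx x 0 i);
    by case: (a == _); case: (b == _); rewrite ?eqxx ?oner_eq0 ?F2_addxx ?addr0 ?add0r.
case/orP => [|/andP[/cards2P[i [j [ij sx]]] /eqP t0]].
  rewrite leq_eqVlt ltnS leqn0 => /orP[/cards1P[i sx]|].
    exists (Some i), None; split; last by right.
    apply: rowE; rewrite sx; apply/setP => k; rewrite !inE (inj_eq Some_inj) eq_sym.
    by case: (i == k).
  rewrite cards_eq0 => /eqP sx; exists None, None; split; last by right.
  by apply: rowE; rewrite sx; apply/setP => k; rewrite !inE.
exists (Some i), (Some j); split; last by left.
apply: rowE; rewrite sx; apply/setP => k; rewrite !inE !(inj_eq Some_inj) ![k == _]eq_sym.
by case: (eqVneq i k) ij => [->|_]; case: (eqVneq j k) => //= ->; rewrite eqxx.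
Qed.

(** * Transport of the matrices along a relabelling of the vertices *)

Section Labelling.

Variable sigma : {perm 'I_6}.
Implicit Types (S : {set complete_edge 6}) (p : nat * nat).

Definition label (i : nat) : 'I_6 := sigma (inord i).
Definition label_pair (p : nat * nat) : {set 'I_6} := [set label p.1; label p.2].
Definition pair_mem (S : {set complete_edge 6}) (p : nat * nat) : bool := label_pair p \in val @: S.

Lemma pairs_bound p : p \in K6_pairs -> (p.1 < p.2 < 6)%N.
Proof. by move: p; apply/allP. Qed.

Lemma label_inj : {in [pred i | i < 6]%N &, injective label}.
Proof.
move=> i j i6 j6 /perm_inj/(congr1 val) /=.
by rewrite !inordK.
Qed.

Lemma label_pair_inj : {in K6_pairs &, injective label_pair}.
Proof.
move=> [i j] [k l] /pairs_bound/andP[/= ij j6] /pairs_bound/andP[/= kl l6] /setP H.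
have i6 := ltn_trans ij j6; have k6 := ltn_trans kl l6.
have mem a : (a < 6)%N -> (label a \in label_pair (i, j)) = (a == i) || (a == j).
  by move=> a6; rewrite !inE; congr (_ || _); apply/eqP/eqP => [/label_inj->|->].
have mem' a : (a < 6)%N -> (label a \in label_pair (k, l)) = (a == k) || (a == l).
  by move=> a6; rewrite !inE; congr (_ || _); apply/eqP/eqP => [/label_inj->|->].
have := H (label i); have := H (label j); have := H (label k); have := H (label l).
rewrite !mem // !mem' // !eqxx !orbT /= => h1 h2 h3 h4.
by congr pair; lia.
Qed.

Lemma edge_pair (e : complete_edge 6) : exists2 p, p \in K6_pairs & val e = label_pair p.
Proof.
have [a [b [ab eab]]] := edge_ends e.
have key c d : val e = [set c; d] -> ((sigma^-1)%g c < (sigma^-1)%g d)%N ->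
    exists2 p, p \in K6_pairs & val e = label_pair p.
  move=> ecd cd; pose i : nat := (sigma^-1)%g c; pose j : nat := (sigma^-1)%g d.
  exists (i, j); last by rewrite ecd /label_pair /label /= !inord_val !permKV.
  have : (i < j < 6)%N by rewrite cd ltn_ord.
  by move: i j {cd ecd} => [|[|[|[|[|[|i]]]]]] [|[|[|[|[|[|j]]]]]]; rewrite ?andbF.
case: (ltngtP ((sigma^-1)%g a) ((sigma^-1)%g b)) => [|ba|/val_inj/perm_inj ab'].
- exact: key.
- by apply: key ba; rewrite eab setUC.
- by rewrite ab' eqxx in ab.
Qed.

Lemma pair_mem_edge S (e : complete_edge 6) p : val e = label_pair p -> pair_mem S p = (e \in S).
Proof. by move=> ep; rewrite /pair_mem -ep (mem_imset _ _ val_inj). Qed.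

Lemma pair_edge p : p \in K6_pairs -> exists e : complete_edge 6, val e = label_pair p.
Proof.
move=> /pairs_bound/andP[p12 p2]; apply: edge_ex.
by apply/eqP => /(label_inj (ltn_trans p12 p2) p2) H; rewrite H ltnn in p12.
Qed.

(** A colouring that defines the cut may be normalized to 0 at the vertex labelled 0; its value at
    [i] is then the membership of the pair [(0, i)]. *)
Lemma cuts_pairs S : cuts S = all (cut_at (pair_mem S)) K6_pairs.
Proof.
apply/cutsP/allP => [[h hS] p pP|H].
  have selE q : q \in K6_pairs -> pair_mem S q = (h (label q.1) != h (label q.2)).
    by move=> /pair_edge[e eq]; rewrite (pair_mem_edge S eq); apply: hS.
  have tE i : (i < 6)%N -> (if i is 0%N then false else pair_mem S (0%N, i)) = (h (label 0) != h (label i)).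
    by case: i => [|[|[|[|[|[|i]]]]]] // _; rewrite ?eqxx ?selE.
  have /andP[p12 p2] := pairs_bound pP.
  rewrite /cut_at selE // !tE // ?(ltn_trans p12 p2) //.
  have [->|->] := F2_cases (h (label 0)); have [->|->] := F2_cases (h (label p.1));
    by have [->|->] := F2_cases (h (label p.2)).
pose t i := if i is 0%N then false else pair_mem S (0%N, i).
exists (fun a => (t ((sigma^-1)%g a))%:R) => e a b eab.
have [p pP ep] := edge_pair e; rewrite -(pair_mem_edge S ep).
have /andP[p12 p2] := pairs_bound pP.
have tl i : (i < 6)%N -> t ((sigma^-1)%g (label i)) = t i by move=> i6; rewrite permK inordK.
have /eqP-> := H p pP; rewrite -/(t p.1) -/(t p.2).
have : [set a; b] = [set label p.1; label p.2] by rewrite -eab ep.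
have nab : a != b by have := valP e; rewrite /= eab cards2; case: (a != b).
move=> /setP sE.
have := sE a; have := sE b; rewrite !inE !eqxx orbT /= => /esym/orP[]/eqP hb /esym/orP[]/eqP ha;
  rewrite ha hb ?tl ?(ltn_trans p12 p2) // in nab *; rewrite ?eqxx // in nab *.
all: by case: (t p.1); case: (t p.2).
Qed.

Lemma sum_pair S p : p \in K6_pairs ->
  \sum_(e in S) (val e == label_pair p)%:R = (pair_mem S p)%:R :> 'F_2.
Proof.
move=> /pair_edge[e ep]; rewrite (pair_mem_edge S ep).
have E (e' : complete_edge 6) : (val e' == label_pair p) = (e' == e) by rewrite -ep val_eqE.
have [eS|eS] := boolP (e \in S); last first.
  by apply: big1 => e' e'S; rewrite E; case: eqP => // ee; rewrite -ee e'S in eS.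
rewrite (bigD1 e) //= E eqxx big1 ?addr0 // => e' /andP[_ /negbTE ee].
by rewrite E ee.
Qed.

Lemma sum_row S r : uniq r -> {subset r <= K6_pairs} ->
  \sum_(e in S) (val e \in map label_pair r)%:R = (row_parity (pair_mem S) r)%:R :> 'F_2.
Proof.
elim: r => [|p r IH] /=; first by rewrite big1.
move=> /andP[pr ur] sr.
have pP : p \in K6_pairs by apply: sr; rewrite mem_head.
have srr : {subset r <= K6_pairs} by move=> q qr; apply: sr; rewrite inE qr orbT.
have mpr : label_pair p \notin map label_pair r.
  apply/negP => /mapP[q qr /label_pair_inj] H; case/negP: pr.
  by rewrite H // srr.
have -> : (pair_mem S p (+) row_parity (pair_mem S) r)%:R =
    (pair_mem S p)%:R + (row_parity (pair_mem S) r)%:R :> 'F_2.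
  by case: (pair_mem S p); case: (row_parity _ r) => //=; rewrite ?addr0 ?add0r ?F2_addxx.
rewrite -IH // -sum_pair // -big_split; apply: eq_bigr => e _ /=; rewrite inE.
by case: eqP => [->|_]; rewrite ?(negbTE mpr) ?addr0 ?add0r.
Qed.

Variables (n : nat) (rows : seq (seq (nat * nat))).
Hypothesis size_rows : size rows = n.+2.
Hypothesis rowsP : all (fun r => uniq r && all (mem K6_pairs) r) rows.

Definition row_vector (e : complete_edge 6) : 'rV['F_2]_(2 + n) :=
  \row_k (val e \in map label_pair (nth [::] rows k))%:R.

Lemma nth_rows k : uniq (nth [::] rows k) /\ {subset nth [::] rows k <= K6_pairs}.
Proof.
have [lt|ge] := ltnP k (size rows); last by rewrite nth_default.
by have /andP[u /allP s] := allP rowsP _ (mem_nth [::] lt).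
Qed.

Lemma zero_sum_row_vector S : zero_sum row_vector S = rows_even (pair_mem S) rows.
Proof.
have sumE k : (\sum_(e in S) row_vector e) 0 k = (row_parity (pair_mem S) (nth [::] rows k))%:R.
  have [u s] := nth_rows k; rewrite summxE -sum_row //.
  by apply: eq_bigr => e _; rewrite mxE.
apply/eqP/(all_nthP [::]) => [S0 i|H].
  rewrite size_rows => i2; have := sumE (Ordinal i2); rewrite S0 mxE /=.
  by case: (row_parity _ _) => // /eqP; rewrite eq_sym oner_eq0.
apply/rowP => k; rewrite sumE [RHS]mxE (negbTE (H k _)) //.
by rewrite size_rows ltn_ord.
Qed.

Lemma block_row_vector (e : complete_edge 6) p : p \in K6_pairs -> val e = label_pair p ->
  block_pair n rows p -> block_vector (row_vector e).
Proof.
move=> pP ep bp; apply: block_vector_card.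
have coord k : row_vector e 0 k = (p \in nth [::] rows k)%:R.
  rewrite mxE ep; congr (_%:R); congr nat_of_bool.
  have [_ s] := nth_rows k; apply/mapP/idP => [[q qr /label_pair_inj ->] //|pr]; last by exists p.
  exact: s.
have -> : #|supp (rsubmx (row_vector e))| =
    count (fun a => p \in nth [::] rows a.+2) (iota 0 n).
  have -> : iota 0 n = index_iota 0 n by rewrite /index_iota subn0.
  rewrite -sum1_card -sum1_count big_mkord; apply: eq_bigl => a; rewrite inE mxE coord /=.
  by case: (p \in _); rewrite ?oner_eq0 ?eqxx.
case/orP: bp => [->//|/and3P[-> p0 p1]]; apply/orP; right; apply/eqP/row2P.
  by rewrite mxE coord (negbTE p0) mxE.
by rewrite mxE coord (negbTE p1) mxE.
Qed.

End Labelling.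

Lemma labelling_ex (e : complete_edge 6) :
  exists sigma : {perm 'I_6}, val e = label_pair sigma (4, 5)%N.
Proof.
have [a [b [ab ->]]] := edge_ends e.
(* The first transposition sends 4 to [a]; the second sends the image [c] of 5 to [b] and fixes [a],
   which differs from [b] and [c]. *)
pose s1 := tperm (inord 4) a; pose c := s1 (inord 5).
have s14 : s1 (inord 4) = a by rewrite tpermL.
have ac : a != c.
  rewrite -s14 (inj_eq perm_inj); apply/eqP => /(congr1 val) /=.
  by rewrite !inordK.
exists (s1 * tperm c b)%g; rewrite /label_pair /label /= !permM s14 -/c tpermL.
by rewrite tpermD // eq_sym.
Qed.

Lemma dual_K6_delete (e : complete_edge 6) :
  exists n (g : complete_edge 6 -> 'rV['F_2]_(2 + n)),
  (forall x, x \in setT :\ e -> block_vector (g x)) /\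
  (forall X : {set complete_edge 6}, X \subset setT :\ e -> zero_sum g X = cuts X).
Proof.
have [sigma eE] := labelling_ex e; exists 8, (row_vector sigma 8 delete_rows); split.
  move=> x; rewrite !inE andbT => xe; have [p pP xp] := edge_pair sigma x.
  apply: (block_row_vector _ pP xp) => //.
  have : p != (4, 5)%N by apply: contra xe => /eqP p45; rewrite -val_eqE xp p45 eE.
  (* The block condition is verified by evaluation on the 14 remaining pairs. *)
  by apply/implyP; move: p pP {xp}; apply/allP.
move=> X sX; rewrite zero_sum_row_vector // (cuts_pairs sigma) delete_rows_cut //.
rewrite (pair_mem_edge X eE); apply/negP => /(subsetP sX).
by rewrite !inE eqxx.
Qed.

Lemma dual_K6_contract (e : complete_edge 6) :
  exists n (g : complete_edge 6 -> 'rV['F_2]_(2 + n)),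
  (forall x, x \in setT :\ e -> block_vector (g x)) /\
  (forall X : {set complete_edge 6}, X \subset setT :\ e ->
     zero_sum g X = cuts X || cuts (e |: X)).
Proof.
have [sigma eE] := labelling_ex e; exists 7, (row_vector sigma 7 contract_rows); split.
  move=> x; rewrite !inE andbT => xe; have [p pP xp] := edge_pair sigma x.
  apply: (block_row_vector _ pP xp) => //.
  have : p != (4, 5)%N by apply: contra xe => /eqP p45; rewrite -val_eqE xp p45 eE.
  by apply/implyP; move: p pP {xp}; apply/allP.
move=> X sX; have eX : e \notin X by apply/negP => /(subsetP sX); rewrite !inE eqxx.
rewrite zero_sum_row_vector // !(cuts_pairs sigma) contract_rows_cut.
have remP p : p \in rem (4, 5)%N K6_pairs -> p \in K6_pairs := @mem_rem _ _ _ _.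
have selU p : p \in rem (4, 5)%N K6_pairs -> pair_mem sigma (e |: X) p = pair_mem sigma X p.
  move=> pR; have [e' e'p] := pair_edge sigma (remP p pR).
  rewrite !(pair_mem_edge _ e'p) in_setU1; case: eqP => // ee.
  have p45 : p = (4, 5)%N.
    by apply: (@label_pair_inj sigma) => //; [apply: remP | rewrite -e'p ee].
  by rewrite p45 in pR.
have cutU : all (cut_at (pair_mem sigma (e |: X))) (rem (4, 5)%N K6_pairs) =
            all (cut_at (pair_mem sigma X)) (rem (4, 5)%N K6_pairs).
  by rewrite /= /cut_at /= !selU.
rewrite !all_K6_pairs cutU -andb_orr; set b := (X in _ = _ && X).
(* [X] and [e |: X] differ at [(4, 5)] and agree on the pairs at 0, so one of them satisfies the cut
   condition there. *)
suff -> : b by rewrite andbT.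
rewrite /b /cut_at /= (selU (0, 4)%N) // (selU (0, 5)%N) // !(pair_mem_edge _ eE) (negbTE eX) setU11.
by case: (_ (+) _).
Qed.

Local Close Scope ring_scope.

Theorem theorem4p4 :
  (forall L : {set 'rV['F_2]_4}, PG32_line L ->
     excluded_minor even_cycle_with_blocking_pair (delete PG32 L)) /\
  excluded_minor even_cycle_with_blocking_pair
    (dual (cycle_matroid (complete_graph 6))).
Proof.
split=> [L [x [y [x0 y0 xy ->]]]|]; split.
- by move=> /block_represented_of_even_cycle; apply: PG32_line_not_block.
- move=> C D sC sD dCD nCD; apply: even_cycle_of_block_represented.
  apply: (@block_represented_minor _ _ (zero_sum point)) sC sD dCD nCD.
  + exact: zero_sum_space.
  + by apply: represented_delete; apply: represented_vector.
  + exact: PG32_line_delete.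
  + exact: PG32_line_contract.
- by move=> /block_represented_of_even_cycle; apply: dual_K6_not_block.
- move=> C D sC sD dCD nCD; apply: even_cycle_of_block_represented.
  apply: (block_represented_minor cuts_space represented_dual_K6) sC sD dCD nCD => e _.
  + exact: dual_K6_delete.
  + exact: dual_K6_contract.
Qed.
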